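(* If $30<k\leq 10^{11}$, then $k$ is not a $P$-integer. Further, if $k$ is even with $30<k\leq 2\cdot 10^{11}$, then $k$ is not a $P$-integer.
   Context: Let $k>1$ be an integer and let $\varphi$ denote Euler's totient function. The integer $k$ is called a $P$-integer if the first $\varphi(k)$ primes coprime to $k$ form a reduced residue system modulo $k$. *)

(* Defs.v *)
From mathcomp Require Import all_boot.

Set Implicit Arguments.
Unset Strict Implicit.
Unset Printing Implicit Defensive.

Definition first_primes_coprime (k n : nat) (s : seq nat) : Prop :=
  [/\ size s = n,
      sorted ltn s,
      (forall p, p \in s -> prime p /\ coprime p k) &
      (forall p q, q \in s -> prime p -> coprime p k -> p < q -> p \in s)].

Definition reduced_residue_system (k : nat) (s : seq nat) : Prop :=
  [/\ uniq s,
      (forall r, r \in s -> coprime r k) &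
      (forall a, coprime a k -> exists! r, r \in s /\ r = a %[mod k])].

Definition P_integer (k : nat) : Prop :=
  1 < k /\
  exists s, first_primes_coprime k (totient k) s /\ reduced_residue_system k s.

(* The list in [P_integer] exists and is unique, so the existential there is
   just a way of naming it. *)
Lemma first_primes_coprime_exists (k n : nat) :
  0 < k -> exists s, first_primes_coprime k n s.
Proof.
move=> k0; elim: n => [|n [s [ss so sp sd]]]; first by exists [::].
have exP : exists p, [&& prime p, coprime p k & p \notin s].
  have [p hp pp] := prime_above (maxn k (\max_(x <- s) x)).
  move: hp; rewrite gtn_max => /andP[kp mp].
  exists p; rewrite pp prime_coprime // gtnNdvd //=.
  by apply/negP => /(@leq_bigmax_seq _ _ xpredT id) /(_ isT); rewrite leqNgt mp.
case: (ex_minnP exP) => p /and3P[pp pk ps] pmin.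
have lt_p q : q \in s -> q < p.
  move=> qs; rewrite ltnNge leq_eqVlt; apply/negP => /orP[/eqP e|h].
    by rewrite e qs in ps.
  by rewrite (sd p q) in ps.
exists (rcons s p); split.
- by rewrite size_rcons ss.
- rewrite (sorted_pairwise ltn_trans) pairwise_rcons -(sorted_pairwise ltn_trans) so andbT.
  by apply/allP => q /lt_p.
- by move=> q; rewrite mem_rcons inE => /orP[/eqP->|/sp].
- move=> r q; rewrite !mem_rcons !inE => /orP[/eqP->|qs] rp rk rq.
    case rs: (r \in s); first by rewrite orbT.
    by have := pmin r; rewrite rp rk rs leqNgt rq => /(_ isT).
  by rewrite (sd r q) ?orbT.
Qed.

Lemma first_primes_coprime_unique (k n : nat) (s t : seq nat) :
  first_primes_coprime k n s -> first_primes_coprime k n t -> s = t.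
Proof.
move=> [ss so sp sd] [ts to_ tp td].
have us := sorted_uniq ltn_trans ltnn so.
have ut := sorted_uniq ltn_trans ltnn to_.
have st : {subset s <= t} \/ {subset t <= s}.
  case: (boolP (all (mem t) s)) => [/allP|/allPn[p ps pt]]; first by left.
  right=> q qt; have [pp pk] := sp p ps; have [qp qk] := tp q qt.
  apply: (sd q p) => //; rewrite ltn_neqAle leqNgt; apply/andP; split.
    by apply: contraNneq pt => <-.
  by apply: contraNN pt => /(td p q qt pp pk).
suff e : s =i t by apply: (irr_sorted_eq ltn_trans ltnn so to_ e).
case: st => h; first by have [] := uniq_min_size us h; rewrite ?ss ?ts.
have le_st : size s <= size t by rewrite ss ts.
by have [_ e] := uniq_min_size ut h le_st; move=> x; rewrite e.
Qed.

(* Main.v *)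
From Stdlib Require Import NArith ZArith Lia.
Require Import Defs.
From mathcomp Require Import all_boot zify.

Set Implicit Arguments.
Unset Strict Implicit.
Unset Printing Implicit Defensive.

(** Let K be k if k is even and 2 k if k is odd: every reduced class modulo K,
    except the one of the prime 2 when k is odd, meets the list of the first
    totient k primes coprime to k if k is a P-integer.

    Chebyshev's ratio (30 n)! n! / ((15 n)! (10 n)! (6 n)!), sharpened by a
    dyadic bootstrap, bounds the number of primes from below and hence the
    listed primes by x K for an explicit x, roughly ln K times totient K / K. So a
    class a in the window between (x - n) K and K meets the list only in a + j K
    with j < n. If small primes not dividing K cover the levels j < n by one class
    each, the Chinese remainder theorem provides a reduced class a of the window
    for which all a + j K are composite, and k is not a P-integer. Which covers
    are possible depends on the small prime divisors of K; a decision tree over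
    them settles all K except those below 122000 and a few arithmetic progressions
    below 4200000.

    For the remaining K there is a prime p such that p + K is a prime, and a
    power c of a small prime not dividing K with p < c < K. As c is not listed,
    the list reaches up to c + K at least, so it contains both p and p + K, which
    are congruent modulo k. *)

(** * Residue classes modulo the even modulus *)

(** A small prime q helps in one of two ways. If q divides K, it lowers totient K / K and with it
    the number n of levels; if not, it covers about n / q of them. Hence the branching on
    divisibility by the small primes in turn. The price of a cover is its modulus: the product of
    the covering primes times the number of candidates has to fit below K, so a large K and few
    levels are wanted, and a sharp lower bound for the number of primes pays directly. The
    thresholds are highest when exactly one of 3 and 5 divides K; these K make up the arithmetic
    progressions left to direct search.

    Passing from an odd k to 2 k keeps the totient and leaves only odd classes. It also turns the
    bound 10^11 into 2 * 10^11, so that both parts of the theorem become one statement about an even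
    K. *)

Definition even_lift (k K : nat) : Prop :=
  ~~ odd K /\ (K = k \/ odd k /\ K = k.*2).

Definition prime_count (x : nat) : nat := count prime (iota 0 x.+1).

Lemma even_lift_totient k K : even_lift k K -> totient K = totient k.
Proof.
case=> _ [->//|[ok ->]].
by rewrite -mul2n totient_coprime ?coprime2n // (_ : totient 2 = 1) ?mul1n.
Qed.

Lemma even_lift_coprime k K a : even_lift k K -> coprime a K -> coprime a k.
Proof.
case=> _ [->//|[ok ->]]; rewrite -mul2n coprimeMr => /andP[]//.
Qed.

Lemma even_lift_gt0 k K : even_lift k K -> 0 < k -> 0 < K.
Proof. by case=> _ [->//|[ok ->]]; rewrite double_gt0. Qed.

Lemma coprime_even_odd a K : ~~ odd K -> coprime a K -> odd a.
Proof.
move=> eK; apply: contraTT => ea.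
have d2 : 2 %| gcdn a K by rewrite dvdn_gcd !dvdn2 ea eK.
by apply/negP => /eqP e; rewrite e in d2.
Qed.

Lemma even_lift_eqmod k K a r : even_lift k K ->
  odd a -> odd r -> r = a %[mod k] -> r = a %[mod K].
Proof.
move=> [_ [->//|[ok ->]]] oa or_ e; rewrite -mul2n.
apply/eqP; rewrite chinese_remainder ?coprime2n //.
by rewrite !modn2 oa or_ e !eqxx.
Qed.

(* The exception [a = K./2 + 2] is the residue class that contains the prime 2
   when [k] is odd. *)
Lemma P_integer_representative k K s a : even_lift k K -> 1 < k ->
  first_primes_coprime k (totient k) s -> reduced_residue_system k s ->
  coprime a K -> a < K -> a != K./2 + 2 ->
  exists j, a + j * K \in s.
Proof.
move=> kK k1 [_ _ sp _] [_ _ sr] cak ltaK na.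
have [r [[rs ra] _]] := sr a (even_lift_coprime kK cak).
have [pr cr] := sp r rs.
have eK : ~~ odd K by case: kK.
have oa := coprime_even_odd eK cak.
have or_ : odd r.
  case: (even_prime pr) => // r2; subst r.
  case: (kK) => _ [Kk|[ok Kk]].
    by subst K; move: (coprime_even_odd eK cr).
  case/negP: na; apply/eqP; rewrite Kk doubleK.
  move: ltaK ra; rewrite Kk => ltaK ra.
  have k2 : 2 < k by case: k k1 ok {kK cr Kk sp sr ltaK rs cak ra} => [|[|[|]]].
  rewrite (modn_small k2) in ra.
  have [lak|lka] := ltnP a k.
    by move: ra oa; rewrite (modn_small lak) => <-.
  have ak : a - k < k by rewrite ltn_subLR // addnn.
  by rewrite -(subnKC lka) ra -[in RHS](subnKC lka) modnDl (modn_small ak).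
have := even_lift_eqmod kK oa or_ ra => eqK.
exists (r %/ K); rewrite addnC -[a](modn_small ltaK) -eqK -divn_eq //.
Qed.

Lemma P_integer_no_collision k s p q :
  first_primes_coprime k (totient k) s -> reduced_residue_system k s ->
  p \in s -> q \in s -> p = q %[mod k] -> p = q.
Proof.
move=> _ [_ sc sr] ps qs e.
have [r [_ ru]] := sr q (sc q qs).
by rewrite -(ru p) // -(ru q).
Qed.

(* A composite representative [c] of its class is not listed, so the list
   reaches [c + K] at least and contains both [p] and [p + K]. *)
Lemma shifted_prime_not_P_integer k K p c : even_lift k K ->
  prime p -> prime (p + K) -> coprime c K -> ~~ prime c ->
  p < c -> c < K -> c != K./2 + 2 -> ~ P_integer k.
Proof.
move=> kK pp pq cc npc pc cK nc [k1 [s [sf sr]]].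
have k0 := ltnW k1.
have [j js] := P_integer_representative kK k1 sf sr cc cK nc.
have j0 : 0 < j.
  rewrite lt0n; apply: contraNneq npc => j0; move: js; rewrite j0 mul0n addn0.
  by case: sf => _ _ sp _ /sp[].
have K0 : 0 < K by apply: leq_trans cK.
have ltq : p + K < c + j * K by rewrite -addSn leq_add // -{1}[K]mul1n leq_mul2r j0 orbT.
have ltp : p < c + j * K by apply: leq_ltn_trans ltq; apply: leq_addr.
have npK : ~~ (p %| K).
  apply/negP => pK.
  have /(prime_nt_dvdP pq) : p %| p + K by rewrite dvdn_addr.
  have p1 : p != 1 by apply: contraTneq pp => ->.
  move=> /(_ p1) e; move: K0; rewrite -(ltn_add2l p) addn0 -e ltnn //.
have cpK : coprime p K by rewrite prime_coprime.
have cqK : coprime (p + K) K by rewrite coprime_sym /coprime gcdnDr -/(coprime K p) coprime_sym.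
have [_ _ _ sd] := sf.
have ps : p \in s by apply: sd js pp (even_lift_coprime kK cpK) ltp.
have qs : p + K \in s by apply: sd js pq (even_lift_coprime kK cqK) ltq.
have kdK : k %| K by case: kK => _ [->//|[_ ->]]; rewrite -muln2 dvdn_mulr.
have e : p = p + K %[mod k] by rewrite -modnDmr (eqP kdK) addn0.
have := P_integer_no_collision sf sr ps qs e.
by move/eqP; rewrite -{1}[p]addn0 eqn_add2l eq_sym -leqn0 leqNgt K0.
Qed.

(** The list is an initial segment of the primes coprime to [k]. An entry above [Y] would force all
    such primes up to [Y] into it, which are already [totient k] many, in addition to itself. *)
Lemma prime_count_coprime_bound k s Y : 0 < k ->
  first_primes_coprime k (totient k) s ->
  totient k + size (primes k) <= prime_count Y ->
  forall r, r \in s -> r <= Y.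
Proof.
move=> k0 [ss so sp sd] hY r rs; rewrite leqNgt; apply/negP => Yr.
have us := sorted_uniq ltn_trans ltnn so.
set L := [seq p <- iota 0 Y.+1 | prime p].
have sub : {subset r :: [seq p <- L | coprime p k] <= s}.
  move=> p; rewrite inE => /orP[/eqP->//|].
  rewrite !mem_filter mem_iota /= add0n ltnS => /and3P[cp pp pY].
  exact: sd rs pp cp (leq_ltn_trans pY Yr).
have uL : uniq L by rewrite filter_uniq ?iota_uniq.
have : size (r :: [seq p <- L | coprime p k]) <= size s.
  apply: uniq_leq_size sub; rewrite /= filter_uniq // andbT !mem_filter mem_iota.
  by rewrite add0n ltnS [r <= Y]leqNgt Yr !andbF.
rewrite /= ss size_filter ltnNge => /negP; apply.
have : count (predC (coprime^~ k)) L <= size (primes k).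
  rewrite -size_filter; apply: uniq_leq_size; first by rewrite filter_uniq.
  move=> p; rewrite !mem_filter /= mem_primes => /and3P[np pp _].
  by rewrite pp k0 /=; move: np; rewrite prime_coprime // negbK.
have szL : size L = prime_count Y by rewrite size_filter.
have := count_predC (coprime^~ k) L; rewrite szL; lia.
Qed.

Lemma uncovered_class_not_P_integer k K Y a : even_lift k K ->
  totient K + size (primes K) <= prime_count Y ->
  coprime a K -> a < K -> a != K./2 + 2 ->
  (forall j, a + j * K <= Y -> ~~ prime (a + j * K)) ->
  ~ P_integer k.
Proof.
move=> kK hY ca aK na h [k1 [s [sf sr]]].
have k0 := ltnW k1.
have [j js] := P_integer_representative kK k1 sf sr ca aK na.
have kdK : k %| K by case: kK => _ [->//|[_ ->]]; rewrite -muln2 dvdn_mulr.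
have hY' : totient k + size (primes k) <= prime_count Y.
  rewrite -(even_lift_totient kK); apply: leq_trans hY; rewrite leq_add2l.
  apply: uniq_leq_size (primes_uniq k) _ => p; rewrite !mem_primes.
  case/and3P=> -> _ pk; rewrite (even_lift_gt0 kK k0) /=; exact: dvdn_trans kdK.
have := prime_count_coprime_bound k0 sf hY' js.
move=> /h; case: sf => _ _ sp _; by have [-> _] := sp _ js.
Qed.

(** * Covering the levels of a residue class by small primes *)

Lemma coprime_prod_primes p (s : seq nat) : prime p ->
  all prime s -> p \notin s -> coprime p (\prod_(q <- s) q).
Proof.
move=> pp; elim: s => [|q s IH] /=; first by rewrite big_nil coprimen1.
case/andP=> pq ps; rewrite inE negb_or big_cons coprimeMr => /andP[npq nps].
by rewrite (IH ps nps) andbT prime_coprime // dvdn_prime2.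
Qed.

Lemma dvdn_prod_mem (s : seq nat) p : p \in s -> p %| \prod_(q <- s) q.
Proof.
by move=> ps; rewrite (big_rem p) //= dvdn_mulr.
Qed.

Lemma chinese_primes (L : seq (nat * nat)) :
  all prime [seq x.1 | x <- L] -> uniq [seq x.1 | x <- L] ->
  exists r, forall x, x \in L -> r = x.2 %[mod x.1].
Proof.
elim: L => [|[p c] L IH] /=; first by exists 0.
case/andP=> pp aL /andP[npL uL]; have [r hr] := IH aL uL.
have co := coprime_prod_primes pp aL npL.
exists (chinese p (\prod_(q <- [seq x.1 | x <- L]) q) c r) => x.
rewrite inE => /orP[/eqP->|xL] /=; first by rewrite chinese_modl.
rewrite -(hr x xL).
have d : x.1 %| \prod_(q <- [seq x.1 | x <- L]) q by apply/dvdn_prod_mem/map_f.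
by rewrite -(modn_dvdm _ d) chinese_modr // modn_dvdm.
Qed.

(** The indices counted form one class modulo [p], so [t %/ p] determines [t]. The bound is T / p
    rounded up. *)
Lemma count_dvdn_progression p M a T : prime p -> ~~ (p %| M) ->
  count (fun t => p %| a + M * t) (iota 0 T) <= (T + p.-1) %/ p.
Proof.
move=> pp npM; have p0 := prime_gt0 pp.
rewrite -size_filter; set L := filter _ _.
rewrite -(size_map (fun t => t %/ p)) -[leqRHS](size_iota 0); apply: uniq_leq_size.
  rewrite map_inj_in_uniq ?filter_uniq ?iota_uniq // => t u.
  rewrite !mem_filter => /andP[ht _] /andP[hu _] e.
  wlog le_tu : t u ht hu e / t <= u.
    move=> H; case: (leqP t u) => [|/ltnW] h; first exact: H.
    by apply/esym/H.
  have : p %| M * (u - t).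
    by rewrite mulnBr -(subnDl a) dvdn_sub.
  rewrite Euclid_dvdM // (negPf npM) /= => d.
  rewrite (divn_eq t p) (divn_eq u p) e; congr (_ + _).
  by apply/esym/eqP; rewrite eqn_mod_dvd.
move=> x /mapP[t]; rewrite mem_filter mem_iota add0n => /andP[_ tT] ->.
rewrite mem_iota add0n /= ltn_divLR //.
have := divn_eq (T + p.-1) p; have := ltn_pmod (T + p.-1) p0.
by move: tT p0; rewrite /=; lia.
Qed.

(** A union bound over [T] consecutive members of the class: each prime divisor of [K] outside [M]
    spoils at most T / p (rounded up) of them, and [z] at most one more, which is the [.+1]. *)
Lemma coprime_in_class K M r lo T z : 0 < K -> 0 < M ->
  (forall p, prime p -> p %| K -> p %| M -> ~~ (p %| r)) ->
  (\sum_(p <- primes K | ~~ (p %| M)) (T + p.-1) %/ p).+1 < T ->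
  exists a, [/\ lo <= a, a < lo + M * T, a = r %[mod M], coprime a K & a != z].
Proof.
move=> K0 M0 hr hT.
(* The least number from [lo] on that is congruent to [r] modulo [M]. *)
pose a0 := lo + (r + (M - lo %% M)) %% M.
have a0r : a0 = r %[mod M].
  rewrite /a0 modnDmr addnCA -modnDmr.
  have -> : lo + (M - lo %% M) = M * (lo %/ M).+1.
    by have := divn_eq lo M; have := ltn_pmod lo M0; lia.
  by rewrite modnMr addn0.
pose good t := coprime (a0 + M * t) K && (a0 + M * t != z).
case: (boolP (has good (iota 0 T))) => [/hasP[t]|/hasPn ng].
  rewrite mem_iota add0n => /andP[_ tT] /andP[g1 g2].
  exists (a0 + M * t); split => //.
  - by rewrite /a0 -addnA leq_addr.
  - rewrite /a0 -addnA ltn_add2l; have := ltn_pmod (r + (M - lo %% M)) M0.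
    by move: tT; nia.
  - by rewrite mulnC addnC modnMDl.
exfalso; move: hT; rewrite ltnNge => /negP; apply.
have hz : count (fun t => a0 + M * t == z) (iota 0 T) <= 1.
  rewrite -size_filter.
  set L := filter _ _; have uL : uniq L by rewrite filter_uniq ?iota_uniq.
  case E : L uL => [//|t [//|u l]] /andP[]; rewrite inE negb_or => /andP[/eqP ntu _] _.
  have: t \in L by rewrite E mem_head.
  have: u \in L by rewrite E !inE eqxx orbT.
  rewrite !mem_filter => /andP[/eqP e1 _] /andP[/eqP e2 _]; case: ntu.
  by apply/eqP; rewrite -(eqn_pmul2l M0) -(eqn_add2l a0) e1 e2.
apply: (@leq_trans (\sum_(t <- iota 0 T) 1)); first by rewrite sum1_size size_iota.
apply: (@leq_trans (\sum_(t <- iota 0 T)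
   ((a0 + M * t == z) + \sum_(p <- primes K | ~~ (p %| M)) (p %| a0 + M * t)))).
  rewrite !big_seq; apply: leq_sum => t /ng; rewrite /good negb_and negbK.
  case/orP=> [nc|->]; last by rewrite addn_gt0.
  suff [p pK pt] : exists2 p, p \in primes K & ~~ (p %| M) && (p %| a0 + M * t).
    apply: leq_trans (leq_addl _ _); rewrite (big_rem p) //=.
    by move/andP: pt => [-> ->].
  have g1 : 1 < gcdn (a0 + M * t) K.
    rewrite ltn_neqAle eq_sym nc gcdn_gt0 K0 orbT //.
  have pp := pdiv_prime g1; set p := pdiv _ in pp *.
  have pg : p %| gcdn (a0 + M * t) K by apply: pdiv_dvd.
  move: pg; rewrite dvdn_gcd => /andP[pa pK].
  exists p; first by rewrite mem_primes pp K0.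
  rewrite pa andbT; apply/negP => pM; have := hr p pp pK pM; case/negP.
  have pa0 : p %| a0 by move: pa; rewrite dvdn_addl // dvdn_mulr.
  move: pa0; rewrite /dvdn -(modn_dvdm r pM) -a0r modn_dvdm //.
rewrite big_split /= exchange_big /= -[leqRHS]add1n; apply: leq_add.
  apply: leq_trans hz; rewrite -sum1_count [leqRHS]big_mkcond /=.
  by apply: leq_sum => t _; case: eqP.
rewrite big_seq_cond [leqRHS]big_seq_cond; apply: leq_sum => p /andP[].
rewrite mem_primes => /and3P[pp _ _] pM.
apply: leq_trans (count_dvdn_progression a0 T pp pM).
rewrite -sum1_count [leqRHS]big_mkcond /=.
by apply: leq_sum => t _; case: (_ %| _).
Qed.

(* The class [a] is chosen with [a = - c * K] modulo [q] for every [(q, c)] in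
   [Q], so that [q] divides [a + j * K] as soon as [j = c] modulo [q]. Modulo the
   primes of [D0] it is [1]; the other prime divisors of [K] are avoided by
   counting the multiples of each of them among [T] candidates. *)
Lemma covered_window_not_P_integer k K n Y lo T (D0 : seq nat) (Q : seq (nat * nat)) :
  even_lift k K -> 0 < K ->
  all prime D0 -> all (fun p => p %| K) D0 -> uniq D0 ->
  all prime [seq x.1 | x <- Q] -> all (fun q => ~~ (q %| K)) [seq x.1 | x <- Q] ->
  uniq [seq x.1 | x <- Q] ->
  (forall j, j < n -> exists2 x, x \in Q & j = x.2 %[mod x.1]) ->
  Y < lo + n * K -> all (fun q => q < lo) [seq x.1 | x <- Q] ->
  lo + (\prod_(p <- D0) p) * (\prod_(x <- Q) x.1) * T <= K ->
  (\sum_(p <- primes K | p \notin D0) (T + p.-1) %/ p).+1 < T ->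
  totient K + size (primes K) <= prime_count Y ->
  ~ P_integer k.
Proof.
move=> kK K0 pD dD uD pQ dQ uQ cov hY hlo hK hT hcount.
(* [x.1.-1 * x.2 * K] is [- x.2 * K] modulo [x.1], written without a negative number. *)
pose L := [seq (p, 1) | p <- D0] ++ [seq (x.1, x.1.-1 * x.2 * K) | x <- Q].
have L1 : [seq x.1 | x <- L] = D0 ++ [seq x.1 | x <- Q].
  by rewrite map_cat -!map_comp /= map_id.
have disj p : p \in D0 -> p \in [seq x.1 | x <- Q] -> False.
  by move=> /(allP dD) pK /(allP dQ); rewrite pK.
have aL : all prime [seq x.1 | x <- L] by rewrite L1 all_cat pD pQ.
have uL : uniq [seq x.1 | x <- L].
  rewrite L1 cat_uniq uD uQ /= andbT; apply/hasPn => p pQ'; apply/negP => pD'.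
  exact: disj pD' pQ'.
have [r hr] := chinese_primes aL uL.
pose M := (\prod_(p <- D0) p) * (\prod_(x <- Q) x.1).
have ME : M = \prod_(p <- D0 ++ [seq x.1 | x <- Q]) p by rewrite big_cat big_map.
have M0 : 0 < M.
  rewrite ME; rewrite big_seq; apply: prodn_cond_gt0 => p pL; apply: prime_gt0.
  by rewrite -L1 in pL; apply: (allP aL).
have Mmem p : prime p -> p %| M -> p \in D0 ++ [seq x.1 | x <- Q].
  move=> pp; apply: contraTT => npM; rewrite ME -prime_coprime //.
  by apply: coprime_prod_primes => //; rewrite -L1.
have MdvdK p : prime p -> p %| K -> (p %| M) = (p \in D0).
  move=> pp pK; apply/idP/idP => [/(Mmem p pp)|pD0]; last first.
    by rewrite ME dvdn_prod_mem // mem_cat pD0.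
  by rewrite mem_cat => /orP[//|/(allP dQ)]; rewrite pK.
have hr1 p : prime p -> p %| K -> p %| M -> ~~ (p %| r).
  move=> pp pK; rewrite MdvdK // => pD0.
  have : (p, 1) \in L by rewrite mem_cat map_f.
  by move=> /hr /= e; rewrite /dvdn e modn_small // prime_gt1.
have hT' : (\sum_(p <- primes K | ~~ (p %| M)) (T + p.-1) %/ p).+1 < T.
  suff -> : \sum_(p <- primes K | ~~ (p %| M)) (T + p.-1) %/ p =
            \sum_(p <- primes K | p \notin D0) (T + p.-1) %/ p by [].
  rewrite big_seq_cond [RHS]big_seq_cond; apply: eq_bigl => p.
  by case: (boolP (p \in primes K)) => //; rewrite mem_primes => /and3P[pp _ pK]; rewrite MdvdK.
have [a [loa aK ar ca na]] := coprime_in_class lo (K./2 + 2) K0 M0 hr1 hT'.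
apply: (uncovered_class_not_P_integer kK hcount ca) na _ => [|j jY].
  exact: leq_trans aK hK.
have jn : j < n.
  have := leq_ltn_trans jY hY; rewrite ltnNge => h; rewrite ltnNge.
  apply: contra h => nj; apply: leq_add => //; by rewrite leq_mul2r nj orbT.
have [x xQ jx] := cov j jn.
have xq : x.1 \in [seq x.1 | x <- Q] by apply: map_f.
have px : prime x.1 by apply: (allP pQ).
have xM : x.1 %| M by rewrite ME dvdn_prod_mem // mem_cat xq orbT.
have d : x.1 %| a + j * K.
  have e : a = x.1.-1 * x.2 * K %[mod x.1].
    rewrite -(modn_dvdm _ xM) ar (modn_dvdm _ xM).
    by apply: (hr (x.1, x.1.-1 * x.2 * K)); rewrite mem_cat (map_f (fun x => (x.1, x.1.-1 * x.2 * K))) ?orbT.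
  rewrite /dvdn -modnDm e -[(j * K) %% _]modnMml jx modnMml modnDm.
  rewrite -mulnA -{2}[x.2 * K]mul1n -mulnDl addn1 prednK ?prime_gt0 // modnMr //.
(* Since [x.1 < lo <= a], the divisor [x.1] is a proper one. *)
apply/negP => pj; have x1 : x.1 != 1 by apply: contraTneq px => ->.
have := prime_nt_dvdP pj x1 d => e.
have := allP hlo _ xq; rewrite e => h.
by move: (leq_trans h loa); rewrite ltnNge leq_addr.
Qed.

(** * Chebyshev's lower bound for the number of primes *)

Lemma dvdn_logn m n : 0 < m -> 0 < n ->
  (forall p, prime p -> logn p m <= logn p n) -> m %| n.
Proof.
move=> m0 n0 h; apply/gcdn_idPl/eqn_from_log => //; first by rewrite gcdn_gt0 m0.
move=> p; rewrite logn_gcd //; apply/minn_idPl.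
by case: (boolP (prime p)) => [/h//|np]; rewrite lognE (negPf np).
Qed.

(** Legendre's formula padded with zero terms, so that the five factorials of Chebyshev's ratio can
    be compared term by term. *)
Lemma logn_fact_wide p n m : prime p -> n <= m ->
  logn p n`! = \sum_(1 <= k < m.+1) n %/ p ^ k.
Proof.
move=> pp nm; rewrite logn_fact // (@big_cat_nat _ _ _ n.+1 1 m.+1) //=.
rewrite (@big_nat_cond _ _ _ n.+1) [X in _ = _ + X]big1 ?addn0 // => k /andP[/andP[nk _] _].
by apply: divn_small; apply: leq_trans (ltnW (ltn_expl k (prime_gt1 pp))).
Qed.

(** All five quotients are floors of fractions of [s = (30 * n) %/ q]. As 1/2 + 1/3 + 1/5 = 1 +
    1/30, the difference of the two sides depends only on [s] modulo 30, a finite check. *)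
Lemma chebyshev_floor n q : 0 < q ->
  (30 * n) %/ q + n %/ q <=
  (15 * n) %/ q + (10 * n) %/ q + (6 * n) %/ q + (q <= 30 * n).
Proof.
move=> q0.
have [lt|le] := ltnP (30 * n) q.
  by rewrite !divn_small //; lia.
set s := (30 * n) %/ q.
have e2 : (15 * n) %/ q = s %/ 2.
  by rewrite /s -divnMA (_ : 30 * n = 15 * n * 2) ?divnMr //; lia.
have e3 : (10 * n) %/ q = s %/ 3.
  by rewrite /s -divnMA (_ : 30 * n = 10 * n * 3) ?divnMr //; lia.
have e5 : (6 * n) %/ q = s %/ 5.
  by rewrite /s -divnMA (_ : 30 * n = 6 * n * 5) ?divnMr //; lia.
have e30 : n %/ q = s %/ 30.
  by rewrite /s -divnMA [q * _]mulnC divnMl.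
rewrite e2 e3 e5 e30; lia.
Qed.

(** For positive [Y] the least common multiple of 1, ..., [Y], that is, the exponential of
    Chebyshev's psi function. *)
Definition prime_power_prod (Y : nat) : nat :=
  \prod_(p <- iota 0 Y.+1 | prime p) p ^ trunc_log p Y.

Lemma prime_power_prod_gt0 Y : 0 < prime_power_prod Y.
Proof. by apply: prodn_cond_gt0 => p pp; rewrite expn_gt0 prime_gt0. Qed.

(** By [chebyshev_floor] the left side exceeds the factorials on the right, in the exponent of [p],
    by at most one for each power of [p] up to [30 * n]. *)
Lemma chebyshev_dvdn n Y : 30 * n <= Y ->
  (30 * n)`! * n`! %| (15 * n)`! * (10 * n)`! * (6 * n)`! * prime_power_prod Y.
Proof.
move=> nY; apply: dvdn_logn => [||p pp].
- by rewrite muln_gt0 !fact_gt0.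
- by rewrite !muln_gt0 !fact_gt0 prime_power_prod_gt0.
rewrite !lognM ?muln_gt0 ?fact_gt0 ?prime_power_prod_gt0 //.
rewrite !(@logn_fact_wide p _ (30 * n)) //; try lia.
apply: (@leq_trans (\sum_(1 <= k < (30 * n).+1)
   ((15 * n) %/ p ^ k + (10 * n) %/ p ^ k + (6 * n) %/ p ^ k + (p ^ k <= 30 * n)))).
  rewrite -big_split /=; apply: leq_sum => k _; apply: chebyshev_floor.
  by rewrite expn_gt0 prime_gt0.
rewrite !big_split /= leq_add2l.
apply: (@leq_trans (trunc_log p (30 * n))).
  apply: (@leq_trans (\sum_(1 <= k < (30 * n).+1) (k <= trunc_log p (30 * n)))).
    apply: leq_sum => k _; case: (boolP (p ^ k <= _)) => // h.
    by rewrite (trunc_log_max (prime_gt1 pp) h).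
  elim: (30 * n) (trunc_log _ _) => [|m IH] t; first by rewrite big_nil.
  rewrite big_nat_recr //=; case: (leqP m.+1 t) => [mt|_]; last by rewrite addn0.
  apply: leq_trans mt; rewrite addn1 ltnS.
  apply: leq_trans (_ : \sum_(1 <= k < m.+1) 1 <= _).
    by apply: leq_sum => k _; apply: leq_b1.
  by rewrite sum_nat_const_nat; lia.
have [pN|Np] := leqP p (30 * n); last first.
  have -> : trunc_log p (30 * n) = 0; last by [].
  by apply/eqP; rewrite trunc_log_eq0; lia.
apply: leq_trans (leq_trunc_log p nY) _.
rewrite -pfactor_dvdn ?prime_power_prod_gt0 // /prime_power_prod.
have pm : p \in iota 0 Y.+1 by rewrite mem_iota; lia.
by rewrite (big_rem p) //= pp dvdn_mulr.
Qed.

(* [30 ^ 30 / (15 ^ 15 * 10 ^ 10 * 6 ^ 6)] *)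
Definition chebyshev_base : nat := N.to_nat 1007769600000.

Lemma factS_prod a m : (a + m)`! = a`! * \prod_(1 <= i < m.+1) (a + i).
Proof.
elim: m => [|m IH]; first by rewrite big_nil addn0 muln1.
by rewrite big_nat_recr //= mulnA -IH addnS factS mulnC.
Qed.

Lemma ratio_induction (F H num den : nat -> nat) C : F 0 = 1 -> H 0 = 1 ->
  (forall m, F m.+1 * den m * H m = C * num m * H m.+1 * F m) ->
  (forall m, m * den m <= m.+1 * num m) ->
  (forall m, 0 < den m) -> (forall m, 0 < H m) -> den 0 <= 13 * num 0 ->
  forall n, 0 < n -> C ^ n * H n <= 13 * n * F n.
Proof.
move=> F0 H0 step ratio den_gt0 H_gt0 le0 n.
elim: n => [//|[_ _|n IH _]].
  have e : F 1 * den 0 = C * num 0 * H 1 by have := step 0; rewrite H0 F0 !muln1.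
  rewrite expn1 muln1 -(leq_pmul2r (den_gt0 0)) -[13 * _ * _]mulnA e.
  apply: leq_trans (_ : C * H 1 * (13 * num 0) <= _); last by lia.
  by rewrite leq_mul2l le0 orbT.
have {}IH := IH isT.
have dp : 0 < den n.+1 * H n.+1 by rewrite muln_gt0 den_gt0 H_gt0.
rewrite -(leq_pmul2r dp).
have -> : 13 * n.+2 * F n.+2 * (den n.+1 * H n.+1) =
  13 * C * H n.+2 * F n.+1 * (n.+2 * num n.+1).
  transitivity (13 * n.+2 * (F n.+2 * den n.+1 * H n.+1)); first by rewrite -!mulnA.
  rewrite step; lia.
apply: leq_trans (_ : 13 * C * H n.+2 * F n.+1 * (n.+1 * den n.+1) <= _); last first.
  by rewrite leq_mul2l ratio orbT.
rewrite expnS.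
have -> : C * C ^ n.+1 * H n.+2 * (den n.+1 * H n.+1) =
  C * H n.+2 * den n.+1 * (C ^ n.+1 * H n.+1).
  by move: (C ^ n.+1) => *; lia.
have -> : 13 * C * H n.+2 * F n.+1 * (n.+1 * den n.+1) =
  C * H n.+2 * den n.+1 * (13 * n.+1 * F n.+1).
  by lia.
by rewrite leq_mul2l IH orbT.
Qed.

Lemma chebyshev_lower n : 0 < n ->
  chebyshev_base ^ n * ((15 * n)`! * (10 * n)`! * (6 * n)`!) <=
  13 * n * ((30 * n)`! * n`!).
Proof.
(* In the quotient of consecutive ratios the factors [30 * n + i] with [i] prime to 30 survive
   above, and those with [i] divisible by at least two of 2, 3, 5 below. *)
pose num n := (30*n+1)*(30*n+7)*(30*n+11)*(30*n+13)*(30*n+17)*(30*n+19)*(30*n+23)*(30*n+29).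
pose den n := (30*n+6)*(30*n+10)*(30*n+12)*(30*n+15)*(30*n+18)*(30*n+20)*(30*n+24)*(30*n+30).
pose F n := (30 * n)`! * n`!.
pose H n := (15 * n)`! * (10 * n)`! * (6 * n)`!.
have step m : F m.+1 * den m * H m = chebyshev_base * num m * H m.+1 * F m.
  rewrite /F /H !mulnS ![_ + _ * m]addnC (factS_prod (30 * m) 30)
    (factS_prod (15 * m) 15) (factS_prod (10 * m) 10) (factS_prod (6 * m) 6) factS.
  set P30 := \prod_(1 <= i < 31) _; set P15 := \prod_(1 <= i < 16) _.
  set P10 := \prod_(1 <= i < 11) _; set P6 := \prod_(1 <= i < 7) _.
  have e : chebyshev_base * num m * (P15 * P10 * P6) = m.+1 * den m * P30.
    rewrite /P30 /P15 /P10 /P6 unlock /= !muln1 /num /den /chebyshev_base.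
    zify; ring.
  move: e; move: (num m) (den m) P30 P15 P10 P6 => N' D' P30 P15 P10 P6.
  move: chebyshev_base (30 * m)`! (15 * m)`! (10 * m)`! (6 * m)`! m`! => C a b c d f e.
  transitivity ((m.+1 * D' * P30) * (a * b * c * d * f)); first by lia.
  by rewrite -e; lia.
have ratio m : m * den m <= m.+1 * num m.
  rewrite /den /num.
  have -> : m.+1 * ((30*m+1)*(30*m+7)*(30*m+11)*(30*m+13)*(30*m+17)*(30*m+19)*(30*m+23)*(30*m+29)) =
    (30*m+7)*(30*m+11)*(30*m+13)*(30*m+17)*(30*m+19)*(30*m+23)*(30*m+29)*((30*m+1)*m.+1) by lia.
  have -> : m * ((30*m+6)*(30*m+10)*(30*m+12)*(30*m+15)*(30*m+18)*(30*m+20)*(30*m+24)*(30*m+30)) =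
    (30*m+6)*(30*m+10)*(30*m+12)*(30*m+15)*(30*m+18)*(30*m+20)*(30*m+24)*(m*(30*m+30)) by lia.
  by do 7 (apply: leq_mul; last by nia); lia.
have den_gt0 m : 0 < den m by rewrite /den; do 7 (rewrite muln_gt0; apply/andP; split; last by lia); lia.
have H_gt0 m : 0 < H m by rewrite /H !muln_gt0 !fact_gt0.
have F0 : F 0 = 1 by rewrite /F !muln0 fact0.
have H0 : H 0 = 1 by rewrite /H !muln0 fact0.
(* The origin of 13: [den 0 / num 0] is about 12.98. *)
have le0 : den 0 <= 13 * num 0 by rewrite /den /num; lia.
exact: (@ratio_induction F H num den chebyshev_base F0 H0 step ratio den_gt0 H_gt0 le0 n).
Qed.

(* A prime [p] with [p ^ 2 > Y] contributes only [p] to [prime_power_prod Y],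
   hence one factor 2 less than [Y] for each [i] with [p * 2 ^ i <= Y]. Bootstrapping
   on this gain brings the bound close to the prime number theorem. *)
Lemma prime_power_prod_bound Y : 0 < Y ->
  2 ^ (\sum_(p <- iota 0 Y.+1 | prime p) \sum_(1 <= i < 6) ((Y < p * p) && (p * 2 ^ i <= Y))) *
  prime_power_prod Y <= Y ^ prime_count Y.
Proof.
move=> Y0; rewrite /prime_power_prod expn_sum -big_split.
rewrite /prime_count -sum1_count expn_sum big_seq_cond [leqRHS]big_seq_cond.
apply: leq_prod => p /andP[]; rewrite mem_iota add0n ltnS => /andP[_ pY] pp.
rewrite expn1 /=; have p1 := prime_gt1 pp.
have [ltY|leY] := ltnP Y (p * p); last first.
  by rewrite big1_eq expn0 mul1n trunc_logP.
have t1 : trunc_log p Y = 1.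
  apply: trunc_log_eq => //; rewrite expn1 pY /=; by rewrite expnS expn1.
rewrite t1 expn1 /=.
have p0 : 0 < p by apply: ltnW.
set i0 := trunc_log 2 (Y %/ p).
apply: (@leq_trans (2 ^ i0 * p)).
  rewrite leq_mul2r; apply/orP; right; rewrite leq_exp2l //.
  apply: (@leq_trans (\sum_(1 <= i < 6) (i <= i0))).
    apply: leq_sum => i _; case: (boolP (_ <= Y)) => // h.
    rewrite (_ : i <= i0) //; apply: trunc_log_max => //.
    by rewrite leq_divRL // mulnC.
  by rewrite unlock /=; case: i0 => [|[|[|[|[|]]]]].
rewrite -leq_divRL //; apply: trunc_logP => //.
by rewrite divn_gt0.
Qed.

Lemma prime_count_half m : prime_count m <= m.+1 %/ 2.
Proof.
rewrite /prime_count; elim/ltn_ind: m => -[|[|[|[|m]]]] // IH.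
have -> : iota 0 m.+4.+1 = iota 0 m.+3 ++ [:: m.+3; m.+4].
  by rewrite -(iotaD 0 m.+3 2) addn2.
rewrite count_cat (_ : count prime [:: m.+3; m.+4] = prime m.+3 + (prime m.+4 + 0)) //.
have h := IH m.+2 (ltnW (ltnSn _)).
have : prime m.+3 + (prime m.+4 + 0) <= 1.
  rewrite addn0; case: (boolP (odd m)) => om.
    suff -> : prime m.+3 = false by case: prime.
    by apply/negP => /even_prime[//|/=]; rewrite om.
  suff -> : prime m.+4 = false by case: prime.
  by apply/negP => /even_prime[//|/=]; rewrite (negPf om).
by move: h; move: (count _ _) (_ + (_ + 0)) => x y; lia.
Qed.

(** After exchanging the sums, level [i] counts the primes up to [Y %/ 2 ^ i] whose square exceeds
    [Y]; the others are at most [sq], hence at most [sq.+1 %/ 2] in number. *)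
Lemma prime_count_dyadic_sum Y sq : Y < (sq.+1) * (sq.+1) ->
  \sum_(1 <= i < 6) (prime_count (Y %/ 2 ^ i) - sq.+1 %/ 2) <=
  \sum_(p <- iota 0 Y.+1 | prime p) \sum_(1 <= i < 6) ((Y < p * p) && (p * 2 ^ i <= Y)).
Proof.
move=> hsq; rewrite exchange_big; apply: leq_sum => i _; rewrite leq_subLR.
apply: leq_trans (leq_add (prime_count_half sq) (leqnn _)).
rewrite -big_mkcondr sum1_count /prime_count -!size_filter.
rewrite -size_cat; apply: uniq_leq_size; first by rewrite filter_uniq ?iota_uniq.
move=> p; rewrite mem_cat !mem_filter !mem_iota !add0n !ltnS /= => /andP[pp ple].
have i0 : 0 < 2 ^ i by rewrite expn_gt0.
have pY : p * 2 ^ i <= Y by rewrite -leq_divRL.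
have pY' : p <= Y by apply: leq_trans pY; rewrite leq_pmulr.
rewrite pp pY pY' !andbT /=; case: (leqP p sq) => //= h.
rewrite ltnNge; apply/negP => h2; move: hsq; rewrite ltnNge => /negP; apply.
by apply: leq_trans h2; apply: leq_mul.
Qed.

(** Logarithms to base 2 without real numbers: [u / v] stands for log2 of [chebyshev_base] from
    below, [E / h] for log2 of [Y] from above, [c] for log2 of [13 * (Y %/ 30)] from above.
    Exponents of 2 are compared after raising to the power [h * v]. *)
Lemma chebyshev_count Y u v h E sq c : 30 <= Y ->
  2 ^ u <= chebyshev_base ^ v -> Y ^ h <= 2 ^ E -> 13 * (Y %/ 30) <= 2 ^ c ->
  Y < sq.+1 * sq.+1 -> 
  h * u * (Y %/ 30) +
    h * v * (\sum_(1 <= i < 6) (prime_count (Y %/ 2 ^ i) - sq.+1 %/ 2)) <=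
  h * v * c + v * E * prime_count Y.
Proof.
move=> Y30 hu hE hc hsq; set n := Y %/ 30 in hc *.
have n0 : 0 < n by rewrite divn_gt0.
have nY : 30 * n <= Y by rewrite mulnC; apply: leq_trunc_div.
have Y0 : 0 < Y by apply: leq_trans Y30.
set S := \sum_(1 <= i < 6) _.
have h1 : chebyshev_base ^ n <= 13 * n * prime_power_prod Y.
  have Hp : 0 < (15 * n)`! * (10 * n)`! * (6 * n)`! by rewrite !muln_gt0 !fact_gt0.
  rewrite -(leq_pmul2r Hp); apply: leq_trans (chebyshev_lower n0) _.
  rewrite -[13 * n * _ * _]mulnA leq_mul2l; apply/orP; right.
  apply: dvdn_leq; first by rewrite muln_gt0 prime_power_prod_gt0.
  by rewrite [prime_power_prod Y * _]mulnC; apply: chebyshev_dvdn.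
have h2 : 2 ^ S * prime_power_prod Y <= Y ^ prime_count Y.
  apply: leq_trans (prime_power_prod_bound Y0); rewrite leq_mul2r; apply/orP; right.
  by rewrite leq_exp2l //; apply: prime_count_dyadic_sum.
have h3 : 2 ^ S * chebyshev_base ^ n <= 2 ^ c * Y ^ prime_count Y.
  apply: leq_trans (_ : 2 ^ S * (13 * n * prime_power_prod Y) <= _).
    by rewrite leq_mul2l h1 orbT.
  by rewrite mulnCA; apply: leq_mul.
have h4 : (2 ^ S * chebyshev_base ^ n) ^ (h * v) <= (2 ^ c * Y ^ prime_count Y) ^ (h * v).
  case: (h * v) => [//|m]; by rewrite leq_exp2r.
rewrite -(@leq_exp2l 2) // !expnD.
apply: leq_trans (_ : (2 ^ S * chebyshev_base ^ n) ^ (h * v) <= _).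
  rewrite expnMn [leqRHS]mulnC -[(2 ^ S) ^ _]expnM [S * _]mulnC leq_mul2r.
  apply/orP; right; rewrite -expnM.
  have -> : h * u * n = u * (h * n) by lia.
  have -> : n * (h * v) = v * (h * n) by lia.
  by rewrite (expnM 2 u) (expnM _ v); case: (h * n) => [//|m]; rewrite leq_exp2r.
apply: leq_trans h4 _; rewrite expnMn; apply: leq_mul; first by rewrite -expnM mulnC.
rewrite -!expnM.
have -> : prime_count Y * (h * v) = h * (v * prime_count Y) by lia.
have -> : v * E * prime_count Y = E * (v * prime_count Y) by lia.
by rewrite (expnM Y h) (expnM 2 E); case: (v * _) => [//|m]; rewrite leq_exp2r.
Qed.

(** * A computed table of lower bounds for the density of primes *)

Lemma Z_of_expn a b : Z.of_nat (a ^ b) = (Z.of_nat a ^ Z.of_nat b)%Z.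
Proof.
elim: b => [//|b IH].
by rewrite expnS Nat2Z.inj_mul IH Nat2Z.inj_succ Z.pow_succ_r //; apply: Zle_0_nat.
Qed.

Lemma Z_of_divn m d : 0 < d -> Z.of_nat (m %/ d) = (Z.of_nat m / Z.of_nat d)%Z.
Proof.
move=> d0; apply: (Z.div_unique _ _ _ (Z.of_nat (m %% d))).
  by left; have := ltn_pmod m d0; move: (m %% d) => r; lia.
by have := divn_eq m d; move: (m %/ d) (m %% d) => q r; lia.
Qed.

Lemma leq_of_Z m n : (Z.of_nat m <= Z.of_nat n)%Z -> m <= n.
Proof. by lia. Qed.

Lemma Z_chebyshev_base : Z.of_nat chebyshev_base = 1007769600000%Z.
Proof. exact: N_nat_Z. Qed.

(** [4984 / 125 = 39.872] is just below log2 of the base, about 39.874. Giving [u] by its value in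
    [Z] keeps a large unary numeral out of the goal. *)
Lemma chebyshev_base_pow u : Z.of_nat u = 4984%Z -> 2 ^ u <= chebyshev_base ^ 125.
Proof.
move=> hu; have hc := Z_chebyshev_base.
move: chebyshev_base hc => c hc; apply: leq_of_Z.
by rewrite !Z_of_expn hu hc; apply/Z.leb_le; vm_compute.
Qed.

(* Endpoints of the quarter octaves: [4096 * 2 ^ (i / 4)] up to rounding, chosen
   so that [grid (4 + i) = 2 * grid i]. *)
Fixpoint grid (i : nat) : Z :=
  match i with
  | j.+4 => (2 * grid j)%Z
  | 3 => 6888%Z
  | 2 => 5792%Z
  | 1 => 4870%Z
  | _ => 4096%Z
  end.

Definition scale : Z := 1000000.

(** Halving moves down four quarter octaves, and [prev] lists the latest interval first; so the
    density at Y / 2^l is entry [4 * l - 1]. The weights are 32 / 2^l. *)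
Fixpoint gain (prev : list Z) (l : nat) : Z :=
  match l with
  | l'.+1 => (gain prev l' + nth 0 prev (4 * l).-1 * 2 ^ (5 - Z.of_nat l))%Z
  | _ => 0%Z
  end.

(* Valid lower bound for [scale * prime_count Y / Y] on the [i]-th interval of
   the grid, given those of the earlier intervals, latest first. It is
   [chebyshev_count] with [u = 4984], [v = 125], [h = 4], [c = 41], multiplied by
   [960 = 30 * 32]. *)
Definition density_step (i : nat) (prev : list Z) : Z :=
  let lo := grid i in
  let hi := grid i.+1 in
  let E := Z.log2_up (hi ^ 4) in
  let l := minn 5 (i %/ 8) in
  let w := ((Z.sqrt hi + 1) / 2)%Z in
  Z.max 0 ((lo * (637952 * scale + 15000 * gain prev l)
    - (637952 * 29 * scale + 15000 * (32 * Z.of_nat l * w * scale + 32 * Z.of_nat l * scale)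
       + 960 * 20500 * scale)) / (120000 * E * lo))%Z.

Fixpoint densities (n : nat) : list Z :=
  match n with
  | 0 => [::]
  | S m => let prev := densities m in density_step m prev :: prev
  end.

(** A running minimum makes each density valid on all of the range from 4096 to its endpoint, not
    only on its own interval. *)
Definition capped (g : Z) (prev : list (Z * Z)) : Z :=
  if prev is (_, g') :: _ then Z.min g g' else g.

Fixpoint cap_densities (ds : list Z) (n : nat) : list (Z * Z) :=
  match ds, n with
  | g :: ds', m.+1 => let prev := cap_densities ds' m in (grid n, capped g prev) :: prev
  | _, _ => [::]
  end.

Definition density_table (n : nat) : list (Z * Z) := cap_densities (densities n) n.

Lemma density_tableS n : density_table n.+1 =
  (grid n.+1, capped (density_step n (densities n)) (density_table n)) :: density_table n.
Proof. by []. Qed.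

Definition density_on (i : nat) (g : Z) : Prop :=
  forall Y : nat, (grid i <= Z.of_nat Y < grid i.+1)%Z ->
    (g * Z.of_nat Y <= scale * Z.of_nat (prime_count Y))%Z.

Lemma grid_pow2 l i : grid (4 * l + i) = (2 ^ Z.of_nat l * grid i)%Z.
Proof.
elim: l => [|l IH]; first by rewrite muln0 Z.mul_1_l.
rewrite mulnS -addnA (_ : grid (4 + (4 * l + i)) = (2 * grid (4 * l + i))%Z) // IH Nat2Z.inj_succ Z.pow_succ_r; last exact: Zle_0_nat.
exact: Z.mul_assoc.
Qed.

Lemma grid_ge i : (4096 <= grid i)%Z.
Proof.
elim/ltn_ind: i => -[|[|[|[|i]]]] IH //.
have := IH i (leqW (leqW (leqW (ltnSn i)))).
by rewrite -[grid i.+4]/(2 * grid i)%Z; lia.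
Qed.

Lemma density_le_scale i g : (grid i < grid i.+1)%Z -> density_on i g -> (g <= scale)%Z.
Proof.
move=> lt /(_ (Z.to_nat (grid i))); have := @grid_ge i.
rewrite Z2Nat.id; last by have := @grid_ge i; lia.
move=> g0 /(_ (conj (Z.le_refl _) lt)).
have := prime_count_half (Z.to_nat (grid i)).
set c := prime_count _ => hc h.
have : (Z.of_nat c <= grid i)%Z by lia.
rewrite /scale in h *; nia.
Qed.

Lemma grid_lt i : (grid i < grid i.+1)%Z.
Proof.
elim/ltn_ind: i => -[|[|[|[|i]]]] IH //.
have := IH i (leqW (leqW (leqW (ltnSn i)))).
by rewrite -[grid i.+4]/(2 * grid i)%Z -[grid i.+4.+1]/(2 * grid i.+1)%Z; lia.
Qed.

(** Halving is exact on the grid, so [Y %/ 2 ^ l] falls into interval [m - 4 * l]. Taking the floor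
    costs at most one unit of density, at most [scale] by [density_le_scale]: this is the 1 in
    [w + 1]. *)
Lemma dyadic_gain m prev Y w l : (4 * l <= m) ->
  (forall i, i < m -> (0 <= nth 0%Z prev (m.-1 - i))%Z /\ density_on i (nth 0%Z prev (m.-1 - i))) ->
  (grid m <= Z.of_nat Y < grid m.+1)%Z -> l <= 5 ->
  (gain prev l * Z.of_nat Y - Z.of_nat l * (32 * scale * (Z.of_nat w + 1)) <=
   32 * scale * Z.of_nat (\sum_(1 <= i < l.+1) (prime_count (Y %/ 2 ^ i) - w)))%Z.
Proof.
move=> lm ok hY l5; elim: l lm l5 => [|l IH] lm l5; first by rewrite big_nil.
have {}IH := IH (leq_trans (leq_mul (leqnn 4) (leqnSn l)) lm) (ltnW l5).
have -> : \sum_(1 <= i < l.+2) (prime_count (Y %/ 2 ^ i) - w) =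
  \sum_(1 <= i < l.+1) (prime_count (Y %/ 2 ^ i) - w) + (prime_count (Y %/ 2 ^ l.+1) - w).
  by rewrite big_nat_recr.
rewrite -[gain prev l.+1]/(gain prev l + nth 0 prev (4 * l.+1).-1 * 2 ^ (5 - Z.of_nat l.+1))%Z.
pose i := m - 4 * l.+1.
have im : i < m by rewrite /i; lia.
have [g0 gok] := ok i im.
have e : m.-1 - i = (4 * l.+1).-1 by rewrite /i; lia.
rewrite e in g0 gok; set g := nth _ _ _ in g0 gok *.
have gs := density_le_scale (grid_lt i) gok.
have mE : m = 4 * l.+1 + i by rewrite /i; lia.
have hi : (grid i <= Z.of_nat (Y %/ 2 ^ l.+1) < grid i.+1)%Z.
  have ZE : Z.of_nat (Y %/ 2 ^ l.+1) = (Z.of_nat Y / 2 ^ Z.of_nat l.+1)%Z.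
    rewrite -[(2 ^ Z.of_nat _)%Z]/(Z.of_nat 2 ^ Z.of_nat l.+1)%Z -Z_of_expn.
    by rewrite Z_of_divn ?expn_gt0.
  have p0 : (0 < 2 ^ Z.of_nat l.+1)%Z by apply: Z.pow_pos_nonneg; lia.
  move: hY; rewrite {1 2}mE -addnS !grid_pow2 ZE => -[h1 h2]; split.
    by apply: Z.div_le_lower_bound.
  by apply: Z.div_lt_upper_bound.
have := gok _ hi; set z := Y %/ 2 ^ l.+1 => hg.
have hz : (Z.of_nat Y < 2 ^ Z.of_nat l.+1 * (Z.of_nat z + 1))%Z.
  have := ltn_ceil Y (_ : 0 < 2 ^ l.+1); rewrite expn_gt0 => /(_ isT) h.
  rewrite -[(2 ^ Z.of_nat _)%Z]/(Z.of_nat 2 ^ Z.of_nat l.+1)%Z -Z_of_expn.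
  by move: h; rewrite -/z; move: (2 ^ l.+1) => q; lia.
have hp : (2 ^ (5 - Z.of_nat l.+1) * 2 ^ Z.of_nat l.+1 = 32)%Z.
  rewrite -Z.pow_add_r; try lia.
  by rewrite (_ : 5 - Z.of_nat l.+1 + Z.of_nat l.+1 = 5)%Z; last lia.
have hq : (0 <= 2 ^ (5 - Z.of_nat l.+1))%Z by apply: Z.pow_nonneg.
have h1 : (g * 2 ^ (5 - Z.of_nat l.+1) * Z.of_nat Y <=
    32 * (g * Z.of_nat z) + 32 * scale)%Z.
  apply: (Z.le_trans _ (g * (2 ^ (5 - Z.of_nat l.+1) * 2 ^ Z.of_nat l.+1) * (Z.of_nat z + 1))).
    rewrite -[X in (X <= _)%Z]Z.mul_assoc -[X in (_ <= X)%Z]Z.mul_assoc.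
    apply: Z.mul_le_mono_nonneg_l => //.
    rewrite -[X in (_ <= X)%Z]Z.mul_assoc; apply: Z.mul_le_mono_nonneg_l => //; lia.
  rewrite hp; lia.
have h2 : (scale * Z.of_nat (prime_count z) - scale * Z.of_nat w <=
   scale * Z.of_nat (prime_count z - w))%Z by rewrite /scale; lia.
rewrite -/z Nat2Z.inj_add Z.mul_add_distr_r.
move: hg h1 h2 IH; move: (\sum_(_ <= _ < _) _) (prime_count z - w) (g * _ * _)%Z (gain _ _ * _)%Z => s d x y.
rewrite /scale; lia.
Qed.

Lemma Z_of_count_bound h u y v S c E p : h * u * y + h * v * S <= h * v * c + v * E * p ->
  (Z.of_nat h * Z.of_nat u * Z.of_nat y + Z.of_nat h * Z.of_nat v * Z.of_nat S <=
   Z.of_nat h * Z.of_nat v * Z.of_nat c + Z.of_nat v * Z.of_nat E * Z.of_nat p)%Z.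
Proof. by lia. Qed.

Lemma density_step_ok m prev :
  (forall i, i < m -> (0 <= nth 0%Z prev (m.-1 - i))%Z /\ density_on i (nth 0%Z prev (m.-1 - i))) ->
  (13 * grid m.+1 <= 30 * 2 ^ 41)%Z ->
  density_on m (density_step m prev).
Proof.
move=> ok hbig Y hY; rewrite /density_step.
set l := minn 5 (m %/ 8); set E := Z.log2_up _; set w := ((Z.sqrt _ + 1) / 2)%Z.
have lo0 := @grid_ge m; have hi0 := @grid_ge m.+1; have lt := grid_lt m.
have E0 : (0 < E)%Z by apply: Z.log2_up_pos; nia.
set num := (_ - _)%Z.
have [neg|pos] := Z.le_gt_cases (num / (120000 * E * grid m)) 0.
  by rewrite Z.max_l // Z.mul_0_l /scale; lia.
rewrite Z.max_r; last by lia.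
set g := (num / _)%Z in pos *.
have hg : (120000 * E * grid m * g <= num)%Z by apply: Z.mul_div_le; nia.
have [u hu] : exists u, Z.of_nat u = 4984%Z by exists (Z.to_nat 4984); apply: Z2Nat.id.
have [c cE] : exists c, Z.of_nat c = 41%Z by exists 41.
have hu' := chebyshev_base_pow hu.
have hE : Y ^ 4 <= 2 ^ Z.to_nat E.
  apply: leq_of_Z; rewrite !Z_of_expn Z2Nat.id; last by lia.
  apply: (Z.le_trans _ (grid m.+1 ^ 4)); first by apply: Z.pow_le_mono_l; lia.
  by apply: (proj2 (Z.log2_up_spec _ _)); nia.
have hsq : Y < (Z.to_nat (Z.sqrt (grid m.+1))).+1 * (Z.to_nat (Z.sqrt (grid m.+1))).+1.
  have := proj2 (Z.sqrt_spec (grid m.+1) _); have := Z.sqrt_nonneg (grid m.+1).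
  move: (Z.sqrt _) => q; move: hY lo0; move: (grid m.+1) (grid m) => ??; nia.
have hc : 13 * (Y %/ 30) <= 2 ^ c.
  by apply: leq_of_Z; rewrite Z_of_expn cE; lia.
have Y30 : 30 <= Y by lia.
have := chebyshev_count Y30 hu' hE hc hsq.
set wn := _.+1 %/ 2.
have wE : Z.of_nat wn = w.
  by rewrite /wn /w (@Z_of_divn _ 2) // Nat2Z.inj_succ Z2Nat.id; last exact: Z.sqrt_nonneg.
have lm : 4 * l <= m by rewrite /l; lia.
have l5 : l <= 5 by rewrite /l; lia.
have := @dyadic_gain m prev Y wn l lm ok hY l5.
set S5 := \sum_(1 <= i < 6) _; set Sl := \sum_(1 <= i < l.+1) _.
have SS : Sl <= S5.
  by rewrite /S5 /Sl (@big_cat_nat _ _ _ l.+1 1 6) //= leq_addr.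
rewrite wE => hS hC; clearbody S5 Sl.
have w0 : (0 <= w)%Z by rewrite -wE; lia.
pose a0 := (637952 * scale + 15000 * gain prev l)%Z.
pose b := (637952 * 29 * scale + 15000 * (32 * Z.of_nat l * w * scale + 32 * Z.of_nat l * scale)
       + 960 * 20500 * scale)%Z.
have b0 : (0 <= b)%Z by rewrite /b /scale; nia.
have hC' : (19936 * Z.of_nat (Y %/ 30) + 500 * Z.of_nat S5 <=
            20500 + 125 * (E * Z.of_nat (prime_count Y)))%Z.
  have EE : Z.of_nat (Z.to_nat E) = E by apply: Z2Nat.id; lia.
  have := Z_of_count_bound hC; rewrite hu cE EE.
  by rewrite -[Z.of_nat 4]/4%Z -[Z.of_nat 125]/125%Z; lia.
have hdiv : (Z.of_nat Y - 29 <= 30 * Z.of_nat (Y %/ 30))%Z by lia.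
have hSS : (Z.of_nat Sl <= Z.of_nat S5)%Z by lia.
have h1 : (a0 * Z.of_nat Y - b <= 120000 * (E * (scale * Z.of_nat (prime_count Y))))%Z.
  have -> : (E * (scale * Z.of_nat (prime_count Y)) =
             scale * (E * Z.of_nat (prime_count Y)))%Z by ring.
  move: hS hC' hdiv hSS; rewrite /a0 /b /scale; clear.
  move: (E * _)%Z (Z.of_nat Sl) (Z.of_nat S5) (Z.of_nat (Y %/ 30)) => ep sl s5 y3.
  by move: (gain _ _) (Z.of_nat Y) (Z.of_nat l) => ???; lia.
(* As [b >= 0], the quotient (a0 Y - b) / Y increases with Y, so the left end of the interval is the
   worst case. *)
have h2 : (120000 * E * g * Z.of_nat Y <= a0 * Z.of_nat Y - b)%Z.
  have {}hg : (120000 * E * grid m * g <= grid m * a0 - b)%Z := hg.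
  move: hg b0 lo0 (proj1 hY); move: (120000 * E)%Z (a0) (b) (grid m) (Z.of_nat Y) (g).
  clear => e a b' l y g' hg b0' lo0' ly.
  have a_ge : (0 <= a - e * g')%Z by nia.
  have : (0 <= (a - e * g') * (y - l))%Z by apply: Z.mul_nonneg_nonneg; lia.
  lia.
have h3 : (120000 * E * (g * Z.of_nat Y) <= 120000 * E * (scale * Z.of_nat (prime_count Y)))%Z by lia.
by apply: (proj2 (Z.mul_le_mono_pos_l _ _ _ _)) h3; lia.
Qed.

Lemma density_step_ge0 m prev : (0 <= density_step m prev)%Z.
Proof. exact: Z.le_max_l. Qed.

Lemma densities_ok n : (13 * grid n <= 30 * 2 ^ 41)%Z ->
  forall i, i < n -> (0 <= nth 0%Z (densities n) (n.-1 - i))%Z /\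
                     density_on i (nth 0%Z (densities n) (n.-1 - i)).
Proof.
elim: n => [//|n IH] hn i.
have hn' : (13 * grid n <= 30 * 2 ^ 41)%Z by have := grid_lt n; lia.
rewrite ltnS leq_eqVlt => /orP[/eqP->|lt].
  rewrite subnn /=; split; first exact: density_step_ge0.
  exact: density_step_ok (IH hn') hn.
have -> : n.+1.-1 - i = (n.-1 - i).+1 by lia.
exact: IH.
Qed.

Lemma density_tableP n h g Y : (13 * grid n <= 30 * 2 ^ 41)%Z ->
  List.In (h, g) (density_table n) -> 4096 <= Y -> (Z.of_nat Y < h)%Z ->
  (g * Z.of_nat Y <= scale * Z.of_nat (prime_count Y))%Z.
Proof.
move=> hn hg Y0 Yh.
elim: n h g hn hg Yh => [//|n IH] h g hn.
have hn' : (13 * grid n <= 30 * 2 ^ 41)%Z by have := grid_lt n; lia.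
rewrite density_tableS; case=> [[<- <-]|]; last exact: IH.
move=> Yn; have [Yg|Yg] := Z.lt_ge_cases (Z.of_nat Y) (grid n).
  have n0 : 0 < n by rewrite lt0n; apply/eqP => n0; move: Yg; rewrite n0 /=; lia.
  have [b [l El]] : exists b l, density_table n = (grid n, b) :: l.
    by case: (n) n0 => [//|n' _]; eexists; eexists.
  have h0 : (b * Z.of_nat Y <= scale * Z.of_nat (prime_count Y))%Z.
    by apply: (IH (grid n)) => //; rewrite El; left.
  rewrite El /capped; set g1 := density_step _ _.
  by have := Z.le_min_r g1 b; nia.
have [g0 gok] := densities_ok hn (ltnSn n).
rewrite subnn in g0 gok.
have h0 : (density_step n (densities n) * Z.of_nat Y <=
           scale * Z.of_nat (prime_count Y))%Z := gok Y (conj Yg Yn).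
rewrite /capped; case: (density_table n) => [//|[a b] l].
by have := Z.le_min_l (density_step n (densities n)) b; nia.
Qed.

(** * Prime divisors of the modulus *)

Lemma prod_primes_split K (L : seq nat) : 0 < K -> uniq L ->
  all prime L -> all (fun p => p %| K) L ->
  perm_eq (primes K) (L ++ [seq p <- primes K | p \notin L]).
Proof.
move=> K0 uL pL dL; apply: uniq_perm; first exact: primes_uniq.
  rewrite cat_uniq uL filter_uniq ?primes_uniq // andbT /=.
  by apply/hasPn => p; rewrite mem_filter => /andP[].
move=> p; rewrite mem_cat mem_filter; case: (boolP (p \in L)) => //= pL'.
by rewrite mem_primes K0 (allP pL _ pL') (allP dL _ pL').
Qed.

Lemma prod_primes_leq K : 0 < K -> \prod_(p <- primes K) p <= K.
Proof.
move=> K0; rewrite {2}(prod_prime_decomp K0) prime_decompE big_map /=.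
rewrite big_seq [leqRHS]big_seq; apply: leq_prod => p pK.
rewrite -{1}[p]expn1 leq_pexp2l //; last by rewrite logn_gt0.
by move: pK; rewrite mem_primes => /andP[/prime_gt0].
Qed.

Lemma size_primes_pow2 K : 0 < K -> 2 ^ size (primes K) <= K.
Proof.
move=> K0; apply: leq_trans (prod_primes_leq K0).
have -> : 2 ^ size (primes K) = \prod_(p <- primes K) 2.
  by rewrite big_const_seq count_predT -Monoid.iteropE /=; elim: size => //= n <-; rewrite expnS.
rewrite big_seq [leqRHS]big_seq; apply: leq_prod => p.
by rewrite mem_primes => /andP[/prime_gt1].
Qed.

Lemma other_primes_bound K (L : seq nat) y : 0 < K -> uniq L ->
  all prime L -> all (fun p => p %| K) L ->
  (forall p, prime p -> p %| K -> p \notin L -> y <= p) ->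
  (\prod_(p <- L) p) * y ^ size [seq p <- primes K | p \notin L] <= K.
Proof.
move=> K0 uL pL dL hy; apply: leq_trans (prod_primes_leq K0).
rewrite (perm_big _ (prod_primes_split K0 uL pL dL)) big_cat /= leq_mul2l; apply/orP; right.
set s := [seq _ <- _ | _].
have : {in s, forall p, y <= p}.
  by move=> p; rewrite mem_filter mem_primes => /and4P[pL' pp _ pK]; apply: hy.
elim: s => [|p s IH] h; first by rewrite big_nil.
rewrite big_cons /= expnS; apply: leq_mul; first by apply: h; rewrite mem_head.
by apply: IH => q qs; apply: h; rewrite inE qs orbT.
Qed.

Lemma totient_prod_leq K (L : seq nat) : 0 < K -> uniq L ->
  all prime L -> all (fun p => p %| K) L ->
  totient K * (\prod_(p <- L) p) <= K * \prod_(p <- L) p.-1.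
Proof.
move=> K0 uL pL dL.
have KE : K = \prod_(p <- primes K) p ^ logn p K.
  by rewrite {1}(prod_prime_decomp K0) prime_decompE big_map.
rewrite totientE // [X in _ <= X * _]KE.
rewrite !(perm_big _ (prod_primes_split K0 uL pL dL)) !big_cat /=.
set s := [seq _ <- _ | _].
rewrite mulnAC [leqRHS]mulnAC; apply: leq_mul.
  rewrite -!big_split /= big_seq [leqRHS]big_seq; apply: leq_prod => p pL'.
  have lp : 0 < logn p K by rewrite logn_gt0 mem_primes K0 (allP pL _ pL') (allP dL _ pL').
  by rewrite -mulnA -expnSr prednK // mulnC.
rewrite big_seq [leqRHS]big_seq; apply: leq_prod => p.
rewrite mem_filter mem_primes => /and4P[_ pp _ pK].
have lp : 0 < logn p K by rewrite logn_gt0 mem_primes pp K0.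
by rewrite -[X in _ <= _ ^ X](prednK lp) expnS leq_mul2r leq_pred orbT.
Qed.

(** Since [T <= y], each unknown prime divisor of [K] spoils at most one candidate, and the size of
    [K] allows at most [w] of them. Only [D1] needs a precise count. *)
Lemma covered_window_sieved k K y (D0 D1 : seq nat) (Q : seq (nat * nat)) n Y lo T w :
  even_lift k K -> 0 < K ->
  all prime (D0 ++ D1) -> uniq (D0 ++ D1) -> all (fun p => p %| K) (D0 ++ D1) ->
  (forall p, prime p -> p %| K -> p \notin D0 ++ D1 -> y <= p) -> 1 < y ->
  all prime [seq x.1 | x <- Q] -> all (fun q => ~~ (q %| K)) [seq x.1 | x <- Q] ->
  uniq [seq x.1 | x <- Q] ->
  (forall j, j < n -> exists2 x, x \in Q & j = x.2 %[mod x.1]) ->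
  Y < lo + n * K -> all (fun q => q < lo) [seq x.1 | x <- Q] ->
  lo + (\prod_(p <- D0) p) * (\prod_(x <- Q) x.1) * T <= K ->
  K < (\prod_(p <- D0 ++ D1) p) * y ^ w.+1 -> T <= y ->
  (\sum_(p <- D1) (T + p.-1) %/ p + w).+1 < T ->
  totient K + size (primes K) <= prime_count Y ->
  ~ P_integer k.
Proof.
move=> kK K0 pD uD dD hy y1 pQ dQ uQ cov hY hlo hK hw Ty hT hcount.
move: (pD) (uD) (dD); rewrite !all_cat cat_uniq => /andP[pD0 pD1] /and3P[uD0 nD uD1] /andP[dD0 dD1].
apply: (@covered_window_not_P_integer k K n Y lo T D0 Q) => //.
apply: leq_ltn_trans hT; rewrite ltnS.
rewrite -big_filter.
have pe : perm_eq [seq p <- primes K | p \notin D0]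
    (D1 ++ [seq p <- primes K | p \notin D0 ++ D1]).
  have := prod_primes_split K0 uD pD dD; rewrite -catA => /(perm_filter (fun p => p \notin D0)).
  move/perm_trans; apply; rewrite !filter_cat.
  have -> : [seq p <- D0 | p \notin D0] = [::].
    by apply/eqP; rewrite -[_ == _]negbK -has_filter; apply/negP => /hasP[p ->].
  have -> : [seq p <- D1 | p \notin D0] = D1.
    apply/all_filterP/allP => p p1; apply/negP => p0.
    by move/hasPn: nD => /(_ p p1); rewrite /= p0.
  rewrite -filter_predI /=.
  rewrite (@eq_filter _ _ (fun p => p \notin D0 ++ D1)) // => p /=.
  by rewrite mem_cat negb_or andbA andbb.
rewrite (perm_big _ pe) big_cat /= leq_add2l.
set s := [seq _ <- _ | _].
have ss : size s <= w.
  rewrite -ltnS -(ltn_exp2l _ _ y1).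
  have := other_primes_bound K0 uD pD dD hy; rewrite -/s => h.
  have : (\prod_(p <- D0 ++ D1) p) * y ^ size s < (\prod_(p <- D0 ++ D1) p) * y ^ w.+1.
    exact: leq_ltn_trans h hw.
  by rewrite ltn_mul2l => /andP[].
apply: leq_trans ss; rewrite -sum1_size big_seq [leqRHS]big_seq.
apply: leq_sum => p; rewrite mem_filter mem_primes => /and4P[np pp _ pK].
have yp := hy p pp pK np.
rewrite -ltnS ltn_divLR ?prime_gt0 //.
by move: (prime_gt0 pp) (leq_trans Ty yp); clear; lia.
Qed.

(** * Decision tree over the small prime divisors of the modulus *)

(** The search for covers is a heuristic that takes for each prime a class with the most uncovered
    levels; its output is validated by [covers_ok]. *)
Definition strip (q c : Z) (lv : list Z) : list Z :=
  filter (fun i => ~~ ((i - c) mod q =? 0)%Z) lv.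

Fixpoint pick (q : Z) (lv cs : list Z) (best : nat) (b : Z) : Z :=
  match cs with
  | c :: cs' => let k := count (fun i => (i - c) mod q =? 0)%Z lv in
                if best < k then pick q lv cs' k c else pick q lv cs' best b
  | [::] => b
  end.

Fixpoint greedy (Q lv : list Z) : list (Z * Z) * list Z :=
  match Q with
  | [::] => ([::], lv)
  | q :: Q' => let c := pick q lv lv 0 0%Z in
               let: (L, rest) := greedy Q' (strip q c lv) in ((q, c) :: L, rest)
  end.

Fixpoint try_first (q : Z) (Q lv cs : list Z) (best : list (Z * Z) * list Z) :=
  match cs with
  | [::] => best
  | c :: cs' =>
      let: (L, rest) := greedy Q (strip q c lv) in
      try_first q Q lv cs' (if size rest < size best.2 then ((q, c) :: L, rest) else best)
  end.

(** The first prime is tried in several classes and the others follow greedily. The initial record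
    has one uncovered level too many, so that any trial beats it. *)
Definition small_cover (lv Q : list Z) : list (Z * Z) * list Z :=
  match Q with
  | [::] => ([::], lv)
  | q :: Q' => try_first q Q' lv (take (Z.to_nat q) lv) ([::], 0%Z :: lv)
  end.

(* Covers of the levels [0, ..., n - 1], indexed by the primes below 17 that are
   available: the left branch of [CNode p] has [p] not dividing [K]. *)
Inductive cover_tree :=
  | CLeaf of list (Z * Z) & list Z
  | CNode of Z & cover_tree & cover_tree.

Fixpoint build_covers (lv ps path : list Z) : cover_tree :=
  match ps with
  | [::] => let: (L, rest) := small_cover lv path in CLeaf L rest
  | p :: ps' => CNode p (build_covers lv ps' (path ++ [:: p])) (build_covers lv ps' path)
  end.

Definition levels (n : nat) : list Z := map Z.of_nat (iota 0 n).

(** A prime [p >= n] meets at most one of the [n] levels, so which of these are available does not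
    matter, only how many: each takes one leftover level. *)
Definition covers : list cover_tree :=
  map (fun n => build_covers (levels n)
         (filter (fun p => p <? Z.of_nat n)%Z [:: 3; 5; 7; 11; 13]%Z) [::]) (iota 0 17).

Fixpoint lookup_cover (t : cover_tree) (Q : list Z) : list (Z * Z) * list Z * list Z :=
  match t with
  | CLeaf L rest => (L, rest, Q)
  | CNode p a b =>
      match Q with
      | q :: Q' => if (q =? p)%Z then lookup_cover a Q' else lookup_cover b Q
      | [::] => lookup_cover b Q
      end
  end.

Definition hit_bound (T : Z) (D : list Z) : Z :=
  foldr (fun p a => (T + p - 1) / p + a)%Z 0%Z D.

(* Searches for [T] with [hit_bound T D + w1 <= T]. *)
Fixpoint enough (fuel : nat) (T w1 : Z) (D : list Z) : option Z :=
  match fuel with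
  | f.+1 => let T' := (hit_bound T D + w1)%Z in
            if (T' <=? T)%Z then Some T else enough f T' w1 D
  | _ => None
  end.

(** A prime divisor of [K] either joins the modulus, which costs a factor [p], or is sieved, which
    costs candidates. Initial segments of [D] are tried for the first role. *)
Fixpoint window (fuel : nat) (m V y w2 : Z) (D : list Z) : bool :=
  match fuel, D with
  | f.+1, p :: D' =>
      let m' := (m * p)%Z in
      if (V <? m' * w2)%Z then false else
      if enough 6 w2 w2 D' is Some T then
        [&& (w2 <=? T)%Z, (T <=? y)%Z & (m' * T <=? V)%Z] || window f m' V y w2 D'
      else window f m' V y w2 D'
  | _, _ => false
  end.

(* [X] is measured in units of [1 / resolution], so that the listed primes are
   at most [X * K / resolution]; [F] bounds [totient K / K] in units of
   [1 / unit_f]. *)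
Definition resolution : Z := 10000.
Definition unit_f : Z := 10000000.

(** [W] is the usable part of the interval below [K], in units of K / [resolution]. The 102 pays for
    a start 100 higher, beyond all covering primes, and for rounding. *)
Definition leaf_at (A X y w2 : Z) (D Q : list Z) (n : nat) : bool :=
  let: (L, rest, Q') := lookup_cover (nth (CLeaf [::] [:: 0%Z]) covers n) Q in
  if (16 < n) || (size Q' < size rest) then false else
  let W := Z.min resolution ((Z.of_nat n + 1) * resolution - X) in
  let m := foldr Z.mul (foldr (fun x a => x.1 * a)%Z resolution L) (take (size rest) Q') in
  window 4 m (A * W - 102 * resolution) y w2 (2%Z :: D).

(* Bounds the number of prime divisors of [K] that are at least [y], when the
   cofactor of the known ones is at most [b]. *)
Fixpoint others (fuel : nat) (z y b : Z) : option nat :=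
  match fuel with
  | f.+1 => if (b <? z)%Z then Some 0
            else if others f (z * y)%Z y b is Some w then Some w.+1 else None
  | _ => None
  end.

(** Entries come with increasing [h], along which the capped density cannot increase, so the first
    admissible entry is the sharpest. *)
Fixpoint find_entry (F : Z) (ents : list (Z * Z * Z)) : option (Z * Z) :=
  match ents with
  | (Fmax, u, s) :: ents' => if (F <? Fmax)%Z then Some (u, s) else find_entry F ents'
  | [::] => None
  end.

(** Two choices are tried: [n] levels with the window above the fractional part of X, or one level
    more with the whole interval below [K]. *)
Definition leaf (A : Z) (ents : list (Z * Z * Z)) (y : Z) (D Q : list Z) (F b : Z) : bool :=
  if find_entry F ents is Some (u, s) then
    if others 20 y y b is Some w then
      let X := (Z.shiftr (F * u) 24 + s)%Z in
      if (X <? resolution)%Z then false else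
      let n := Z.to_nat (X / resolution) in
      let w2 := Z.of_nat w.+2 in
      leaf_at A X y w2 D Q n || leaf_at A X y w2 D Q n.+1
    else false
  else false.

(* The primes in [D] divide [K], those in [Q] do not, and the primes from the
   head of [ps] on are undecided; [b] bounds the cofactor of [2] and [D]. *)
Fixpoint tree (qmin : nat) (A : Z) (ents : list (Z * Z * Z)) (ps D Q : list Z) (F b : Z) : bool :=
  match ps with
  | [::] => false
  | y :: ps' =>
      if (b =? 0)%Z then true else
      if (qmin <= size Q) && leaf A ents y D Q F b then true else
      tree qmin A ents ps' (D ++ [:: y]) Q (F - F / y)%Z (b / y)%Z &&
      tree qmin A ents ps' D (Q ++ [:: y]) F b
  end.

Definition odd_primes : list Z :=
  [:: 3; 5; 7; 11; 13; 17; 19; 23; 29; 31; 37; 41; 43; 47; 53; 59; 61; 67; 71; 73; 79; 83]%Z.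

(* 38 for the prime divisors of [K < 2 ^ 38], and 2 for rounding. *)
Definition slack : Z := 40.

(* For [F] below the first component, [F * u / 2 ^ 24 + s] is an admissible [X]
   on the range [A < K <= B], by the density [g] valid below [h]. *)
Definition mk_entry (A B : Z) (hg : Z * Z) : Z * Z * Z :=
  let: (h, g) := hg in
  let u := (resolution * scale * 2 ^ 24 / (g * unit_f) + 1)%Z in
  let s := (slack * scale * resolution / (g * A) + 2)%Z in
  ((((resolution * h - 1) / B - s) * 2 ^ 24 / u)%Z, u, s).

Fixpoint tree_chain (qmin : nat) (tab : list (Z * Z)) (Bs ps D Q : list Z) (F fd : Z) : bool :=
  match Bs with
  | B :: ((A :: _) as Bs') =>
      tree qmin A
        (map (mk_entry A B) (take 24 (filter (fun x => (2 * B <=? x.1)%Z) tab)))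
        ps D Q F (B / fd) &&
      tree_chain qmin tab Bs' ps D Q F fd
  | _ => true
  end.

(** * Soundness of the decision tree *)

Definition entry_ok (A B : Z) (e : Z * Z * Z) : Prop :=
  let: (Fmax, u, s) := e in
  forall F, (0 <= F < Fmax)%Z ->
  let X := (Z.shiftr (F * u) 24 + s)%Z in (resolution <= X)%Z ->
  forall K phi : nat, (A < Z.of_nat K <= B)%Z -> (unit_f * Z.of_nat phi <= F * Z.of_nat K)%Z ->
  phi + 38 <= prime_count (Z.to_nat (X * Z.of_nat K / resolution)).

(** [u] turns totient K / K into a multiple of [K] by dividing by the density, [s] absorbs the
    additive slack because [K > A], and the limit on [F] keeps the resulting bound below [h] because
    [K <= B]. *)
Lemma mk_entry_ok A B h g : (4096 <= A)%Z -> (0 < g <= scale)%Z ->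
  (forall Y, 4096 <= Y -> (Z.of_nat Y < h)%Z ->
     (g * Z.of_nat Y <= scale * Z.of_nat (prime_count Y))%Z) ->
  entry_ok A B (mk_entry A B (h, g)).
Proof.
move=> A0 [g0 gs] dens; rewrite /mk_entry /entry_ok.
set u := (_ / (g * unit_f) + 1)%Z; set s := (_ / (g * A) + 2)%Z.
move=> F [F0 FM]; rewrite Z.shiftr_div_pow2 //.
set X0 := (F * u / 2 ^ 24)%Z => XR K phi [AK KB] hphi.
have hu : (resolution * scale * 2 ^ 24 < g * unit_f * u)%Z.
  have := Z.mul_succ_div_gt (resolution * scale * 2 ^ 24) (g * unit_f).
  by rewrite -/u /Z.succ; apply; rewrite /unit_f; lia.
have hs : (slack * scale * resolution < g * A * (s - 1))%Z.
  have := Z.mul_succ_div_gt (slack * scale * resolution) (g * A).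
  rewrite (_ : s - 1 = Z.succ (slack * scale * resolution / (g * A)))%Z; last by rewrite /s; lia.
  by apply; nia.
have u0 : (0 < u)%Z by move: hu; rewrite /resolution /scale /unit_f; nia.
have hX0 : (F * u < 2 ^ 24 * (X0 + 1))%Z by apply: Z.mul_succ_div_gt.
have hX0' : (2 ^ 24 * X0 <= F * u)%Z by apply: Z.mul_div_le.
have B0 : (0 < B)%Z by lia.
have XB : ((X0 + s) * B < resolution * h)%Z.
  have h1 := Z.mul_div_le (((resolution * h - 1) / B - s) * 2 ^ 24) u u0.
  have h2 := Z.mul_div_le (resolution * h - 1) B B0.
  move: FM h1 h2; set c := ((resolution * h - 1) / B)%Z; set Fm := (_ / u)%Z => FM h1 h2.
  have h3 : (F * u < Fm * u)%Z by apply: (proj1 (Z.mul_lt_mono_pos_r _ _ _ u0)).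
  have : (X0 < c - s)%Z by lia.
  by nia.
set Y := (_ / resolution)%Z.
have Y1 : (resolution * Y <= (X0 + s) * Z.of_nat K)%Z by apply: Z.mul_div_le.
have Y2 : ((X0 + s) * Z.of_nat K < resolution * (Y + 1))%Z by apply: Z.mul_succ_div_gt.
have YK : (Z.of_nat K <= Y)%Z by apply: Z.div_le_lower_bound => //; nia.
have Yh : (Y < h)%Z by rewrite /resolution in XB XR Y1 *; nia.
have YE : Z.of_nat (Z.to_nat Y) = Y by apply: Z2Nat.id; lia.
have := dens (Z.to_nat Y); rewrite YE => /(_ _ Yh) hd.
have {}hd := hd (_ : 4096 <= Z.to_nat Y); move: hd => /(_ ltac:(lia)).
set p := prime_count _ => hd.
have h1 : (F * (resolution * scale) <= unit_f * g * (X0 + 1))%Z.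
  have : (F * (resolution * scale * 2 ^ 24) <= F * (g * unit_f * u))%Z by apply: Z.mul_le_mono_nonneg_l; lia.
  have : (g * unit_f * (F * u) <= g * unit_f * (2 ^ 24 * (X0 + 1)))%Z.
    by apply: Z.mul_le_mono_nonneg_l; rewrite /unit_f; lia.
  by rewrite /resolution /scale /unit_f; lia.
have h2 : (scale * resolution * (Z.of_nat phi + slack) <= g * ((X0 + s) * Z.of_nat K))%Z.
  have e1 : (F * (resolution * scale) * Z.of_nat K <= unit_f * g * (X0 + 1) * Z.of_nat K)%Z.
    by apply: Z.mul_le_mono_nonneg_r; lia.
  have e2 : (slack * scale * resolution <= g * (s - 1) * Z.of_nat K)%Z.
    have : (g * (s - 1) * A <= g * (s - 1) * Z.of_nat K)%Z.
      apply: Z.mul_le_mono_nonneg_l; last by lia.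
      by apply: Z.mul_nonneg_nonneg; [lia | rewrite /slack /scale /resolution in hs; nia].
    lia.
  have e3 : (unit_f * Z.of_nat phi * (resolution * scale) <= F * Z.of_nat K * (resolution * scale))%Z.
    by apply: Z.mul_le_mono_nonneg_r.
  rewrite /unit_f /resolution /scale /slack in e1 e2 e3 *; lia.
have h3 : (g * ((X0 + s) * Z.of_nat K) <= g * (resolution * (Y + 1)))%Z.
  by apply: Z.mul_le_mono_nonneg_l; lia.
have h4 : (g * resolution <= scale * resolution)%Z by apply: Z.mul_le_mono_nonneg_r.
by rewrite /scale /resolution /slack in h2 h3 h4 hd; lia.
Qed.

(* [rest] lists the levels that [L] leaves uncovered; each of them is later
   covered by a prime of its own. *)
Definition covered (L : list (Z * Z)) (rest : list Z) (j : Z) : bool :=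
  has (fun x => (j - x.2) mod x.1 =? 0)%Z L || has (Z.eqb j) rest.

Fixpoint eqseqZ (s t : list Z) : bool :=
  match s, t with
  | [::], [::] => true
  | x :: s', y :: t' => (x =? y)%Z && eqseqZ s' t'
  | _, _ => false
  end.

Lemma eqseqZP s t : eqseqZ s t -> s = t.
Proof.
by elim: s t => [|x s IH] [|y t] //= /andP[/Z.eqb_eq -> /IH ->].
Qed.

Fixpoint cover_tree_ok (n : nat) (path : list Z) (t : cover_tree) : bool :=
  match t with
  | CLeaf L rest =>
      [&& eqseqZ (map fst L) path,
          all (fun x => 0 <=? x.2)%Z L & all (covered L rest) (levels n)]
  | CNode p a b => cover_tree_ok n (path ++ [:: p]) a && cover_tree_ok n path b
  end.

Lemma covers_ok : all (fun n => cover_tree_ok n [::] (nth (CLeaf [::] [:: 0%Z]) covers n)) (iota 0 17).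
Proof. by vm_compute. Qed.

Lemma lookup_cover_ok n t Q path L rest Q' : cover_tree_ok n path t ->
  lookup_cover t Q = (L, rest, Q') ->
  [/\ path ++ Q = map fst L ++ Q', all (fun x => 0 <=? x.2)%Z L &
      all (covered L rest) (levels n)].
Proof.
elim: t path Q => [M r|p a IHa b IHb] path Q /=.
  by case/and3P=> /eqseqZP <- h1 h2 [<- <- <-].
case/andP=> ha hb; case: Q => [|q Q]; first exact: IHb hb.
case: (Z.eqb_spec q p) => [->|_]; last exact: IHb hb.
by move=> /(IHa _ _ ha); rewrite -catA.
Qed.

Lemma window_cons fuel m V y w2 p D : window fuel.+1 m V y w2 (p :: D) =
  if (V <? m * p * w2)%Z then false else
  if enough 6 w2 w2 D is Some T then
    [&& (w2 <=? T)%Z, (T <=? y)%Z & (m * p * T <=? V)%Z] || window fuel (m * p) V y w2 D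
  else window fuel (m * p) V y w2 D.
Proof. by []. Qed.

Lemma window_ok fuel m V y w2 D : window fuel m V y w2 D ->
  exists D0 D1 T, [/\ D = D0 ++ D1, (w2 <= T <= y)%Z,
    (foldl Z.mul m D0 * T <= V)%Z & (hit_bound T D1 + w2 <= T)%Z].
Proof.
have enoughP f T0 E T : enough f T0 w2 E = Some T -> (hit_bound T E + w2 <= T)%Z.
  by elim: f T0 => [//|f IH] T0 /=; case: Z.leb_spec => [h [<-]|_ /IH].
elim: fuel m D => [|fuel IH] m [|p D] //; rewrite window_cons.
case: (V <? _)%Z => //.
have rec : window fuel (m * p) V y w2 D ->
  exists D0 D1 T, [/\ p :: D = D0 ++ D1, (w2 <= T <= y)%Z,
    (foldl Z.mul m D0 * T <= V)%Z & (hit_bound T D1 + w2 <= T)%Z].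
  by move=> /IH[D0 [D1 [T [-> h1 h2 h3]]]]; exists (p :: D0), D1, T.
case E : (enough _ _ _ _) => [T|] //; case/orP => // /and3P[].
move=> /Z.leb_le h1 /Z.leb_le h2 /Z.leb_le h3.
by exists [:: p], D, T; split => //; apply: enoughP E.
Qed.

Lemma map_Z_of_nat_cat (s : seq nat) (t u : list Z) : map Z.of_nat s = t ++ u ->
  exists t' u', [/\ s = t' ++ u', t = map Z.of_nat t' & u = map Z.of_nat u'].
Proof.
elim: t s => [|x t IH] s /=; first by exists [::], s.
case: s => [//|y s] /= [<- /IH[t' [u' [-> -> ->]]]].
by exists (y :: t'), u'.
Qed.

Lemma foldr_mul_prod (s : seq nat) a :
  foldr Z.mul a (map Z.of_nat s) = (Z.of_nat (\prod_(p <- s) p) * a)%Z.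
Proof.
elim: s => [|x s IH] /=; first by rewrite big_nil Z.mul_1_l.
by rewrite big_cons IH; lia.
Qed.

Lemma foldl_mul_prod (s : seq nat) a :
  foldl Z.mul a (map Z.of_nat s) = (a * Z.of_nat (\prod_(p <- s) p))%Z.
Proof.
elim: s a => [|x s IH] a /=; first by rewrite big_nil Z.mul_1_r.
by rewrite big_cons IH; lia.
Qed.

Lemma foldr_fst_prod (L : list (Z * Z)) (s : seq nat) a : map fst L = map Z.of_nat s ->
  foldr (fun x a => x.1 * a)%Z a L = (Z.of_nat (\prod_(p <- s) p) * a)%Z.
Proof.
elim: L s => [|x L IH] [|y s] //=; first by rewrite big_nil Z.mul_1_l.
by case=> -> /IH ->; rewrite big_cons; lia.
Qed.

Lemma hit_bound_nat T (D : seq nat) : all prime D ->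
  hit_bound (Z.of_nat T) (map Z.of_nat D) = Z.of_nat (\sum_(p <- D) (T + p.-1) %/ p).
Proof.
elim: D => [|p D IH] /=; first by rewrite big_nil.
case/andP=> pp /IH ->; rewrite big_cons Nat2Z.inj_add Z_of_divn ?prime_gt0 //.
by congr (_ / _ + _)%Z; have := prime_gt0 pp; lia.
Qed.

Lemma eqmod_of_Z (j c q : nat) : 0 < q ->
  ((Z.of_nat j - Z.of_nat c) mod Z.of_nat q)%Z = 0%Z -> j = c %[mod q].
Proof.
move=> q0 /Z.mod_divide h; have [|t ht] := h; first by lia.
have [le|lt] := leqP c j.
  have e : j = Z.to_nat t * q + c by nia.
  by rewrite e modnMDl.
have e : c = Z.to_nat (- t) * q + j by nia.
by rewrite e modnMDl.
Qed.

Lemma has_zip_class (L : list (Z * Z)) (S : seq nat) (j : nat) :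
  map fst L = map Z.of_nat S -> all (fun x => 0 <=? x.2)%Z L -> all prime S ->
  has (fun x => (Z.of_nat j - x.2) mod x.1 =? 0)%Z L ->
  exists2 x, x \in zip S [seq Z.to_nat x.2 | x <- L] & j = x.2 %[mod x.1].
Proof.
elim: L S => [//|[q c] L IH] [//|p S] /= [-> e] /andP[/Z.leb_le c0 aL] /andP[pp pS].
case/orP=> [/Z.eqb_eq h|/(IH S e aL pS)[x xz jx]].
  exists (p, Z.to_nat c); first by rewrite mem_head.
  by apply: eqmod_of_Z; rewrite ?prime_gt0 //= Z2Nat.id.
by exists x => //; rewrite inE xz orbT.
Qed.

Lemma has_zip_eq (rest : list Z) (S : seq nat) (j : nat) : size S = size rest ->
  has (Z.eqb (Z.of_nat j)) rest ->
  exists2 x, x \in zip S [seq Z.to_nat i | i <- rest] & j = x.2.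
Proof.
elim: rest S => [//|i rest IH] [//|p S] /= [e] /orP[/Z.eqb_eq h|/(IH S e)[x xz jx]].
  by exists (p, Z.to_nat i); rewrite ?mem_head //= -h Nat2Z.id.
by exists x => //; rewrite inE xz orbT.
Qed.

Lemma leaf_at_ok k K A B X y w (Dn Qn : seq nat) n :
  even_lift k K -> (0 <= A < Z.of_nat K)%Z -> (Z.of_nat K <= B)%Z -> (resolution <= X)%Z ->
  all prime (2 :: Dn) -> uniq (2 :: Dn) -> all (fun p => p %| K) (2 :: Dn) ->
  (forall p, prime p -> p %| K -> p \notin 2 :: Dn -> y <= p) -> 1 < y ->
  all prime Qn -> uniq Qn -> all (fun q => ~~ (q %| K)) Qn -> all (fun q => q < 100) Qn ->
  (B < Z.of_nat (\prod_(p <- 2%N :: Dn) p) * Z.of_nat (y ^ w.+1))%Z ->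
  totient K + size (primes K) <= prime_count (Z.to_nat (X * Z.of_nat K / resolution)) ->
  leaf_at A X (Z.of_nat y) (Z.of_nat w.+2) (map Z.of_nat Dn) (map Z.of_nat Qn) n ->
  ~ P_integer k.
Proof.
move=> kK [A0 AK] KB XR pD uD dD hy y1 pQ uQ dQ Q100 hw hcount.
have K0 : 0 < K by lia.
rewrite /leaf_at; case E : (lookup_cover _ _) => [[L rest] Q'].
case: ifP => // /negbT; rewrite negb_or -!leqNgt => /andP[n16 szr].
have n17 : n \in iota 0 17 by rewrite mem_iota.
have [eQ hL hcov] := lookup_cover_ok (allP covers_ok n n17) E.
rewrite cat0s in eQ; have [S1 [S2 [eS eS1 eS2]]] := map_Z_of_nat_cat eQ.
set W := Z.min _ _.
rewrite -[(2%Z :: _)]/(map Z.of_nat (2 :: Dn)) => /window_ok[D0z [D1z [T [eD [Tw Ty] hm hT]]]].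
have [D0 [D1 [eD0 eD0z eD1z]]] := map_Z_of_nat_cat eD; subst D0z D1z Q'.
pose Tn := Z.to_nat T; have TE : T = Z.of_nat Tn by rewrite /Tn Z2Nat.id //; move: Tw; clear; lia.
pose rn := map Z.to_nat rest.
pose S3 := take (size rest) S2.
pose Ln := [seq Z.to_nat x.2 | x <- L].
pose Qp := zip S1 Ln ++ zip S3 rn.
have szL : size S1 = size Ln by rewrite size_map -(size_map fst L) eS1 size_map.
have sz3 : size S3 = size rn.
  by rewrite size_map size_take; move: szr; rewrite size_map; case: ltnP => // ??; apply/eqP; rewrite eqn_leq; apply/andP.
have Q1 : [seq x.1 | x <- Qp] = S1 ++ S3.
  by rewrite map_cat -!/(unzip1 _) !unzip1_zip ?szL ?sz3.
have eQn : Qn = (S1 ++ S3) ++ drop (size rest) S2 by rewrite eS -catA cat_take_drop.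
have sub : {subset [seq x.1 | x <- Qp] <= Qn}.
  by rewrite Q1 => q qs; rewrite eQn mem_cat qs.
pose Y := Z.to_nat (X * Z.of_nat K / resolution).
(* The subtraction may truncate to 0. The summand 100 puts every covering prime below [lo]. *)
pose lo := Y.+1 - n * K + 100.
have YE : Z.of_nat Y = (X * Z.of_nat K / resolution)%Z.
  by apply: Z2Nat.id; apply: Z.div_pos => //; move: XR; rewrite /resolution; clear; nia.
have Y1 : (resolution * Z.of_nat Y <= X * Z.of_nat K)%Z.
  by rewrite YE; apply: Z.mul_div_le.
move: pD uD dD hy hw; rewrite eD0 => pD uD dD hy hw.
have pD1 : all prime D1 by move: pD; rewrite all_cat => /andP[].
have hM : (resolution * (Z.of_nat (\prod_(p <- D0) p * \prod_(x <- Qp) x.1) * T) <=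
           A * W - 102 * resolution)%Z.
  move: hm; rewrite foldl_mul_prod -map_take foldr_mul_prod (foldr_fst_prod _ eS1).
  have -> : \prod_(x <- Qp) x.1 = \prod_(p <- S1) p * \prod_(p <- S3) p.
    by rewrite -(big_map (fun x => x.1) xpredT id) Q1 big_cat.
  by rewrite /S3; clear; lia.
move: hT; rewrite TE hit_bound_nat // => hT.
apply: (@covered_window_sieved k K y D0 D1 Qp n Y lo Tn w) => //.
- apply/allP => q /sub; exact: (allP pQ).
- apply/allP => q /sub; exact: (allP dQ).
- by rewrite Q1; move: uQ; rewrite eQn cat_uniq => /andP[].
- move=> j jn.
  have : covered L rest (Z.of_nat j).
    by move: hcov; rewrite /levels all_map => /allP/(_ j); apply; rewrite mem_iota.
  have pS1 : all prime S1 by move: pQ; rewrite eS all_cat => /andP[].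
  case/orP=> [/(has_zip_class eS1 hL pS1)[x xz jx]|hj].
    by exists x => //; rewrite mem_cat xz.
  have [|x xz jx] := @has_zip_eq rest S3 j _ hj; first by rewrite sz3 size_map.
  by exists x; rewrite ?mem_cat ?xz ?orbT //= -jx.
- by rewrite /lo; move: (n * K) (Y) => a b; clear; lia.
- by apply/allP => q /sub /(allP Q100) h; apply: leq_trans h _; rewrite /lo leq_addl.
- have T0 : 0 < Tn by move: Tw; rewrite TE; clear; lia.
  set M := \prod_(p <- D0) p * _ in hM *.
  have AW : (A * W <= Z.of_nat K * W)%Z.
    by apply: Z.mul_le_mono_nonneg_r; [move: hM A0; rewrite TE /resolution; clear; nia | exact: Z.lt_le_incl].
  have W1 : (W <= resolution)%Z by apply: Z.le_min_l.
  have W2 : (W <= (Z.of_nat n + 1) * resolution - X)%Z by apply: Z.le_min_r.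
  have h1 : (Z.of_nat K * W <= Z.of_nat K * resolution)%Z by apply: Z.mul_le_mono_nonneg_l => //; apply: Zle_0_nat.
  have h2 : (Z.of_nat K * W <= Z.of_nat K * ((Z.of_nat n + 1) * resolution - X))%Z.
    by apply: Z.mul_le_mono_nonneg_l => //; apply: Zle_0_nat.
  apply: leq_of_Z; rewrite Nat2Z.inj_add Nat2Z.inj_mul.
  have hlo : (Z.of_nat lo <= 100)%Z \/ (Z.of_nat lo = Z.of_nat Y + 1 - Z.of_nat n * Z.of_nat K + 100)%Z.
    rewrite /lo; case: (leqP Y.+1 (n * K)) => h; [left | right]; move: h; clear; lia.
  rewrite TE in hM; move: hM h1 h2 hlo Y1 AW; rewrite /resolution.
  move: (Z.of_nat M * Z.of_nat Tn)%Z (Z.of_nat lo) (A * W)%Z (Z.of_nat K * W)%Z => a l aw kw.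
  by clear; move=> ??? [?|?] ??; lia.
- by move: hw KB; clear; lia.
- by move: Ty; rewrite TE; clear; lia.
- by move: hT; clear; lia.
Qed.

Lemma find_entry_ok A B F ents u s : List.Forall (entry_ok A B) ents ->
  find_entry F ents = Some (u, s) ->
  exists2 Fmax, entry_ok A B (Fmax, u, s) & (F < Fmax)%Z.
Proof.
elim: ents => [_ //|[[Fm u'] s'] ents IH] /List.Forall_cons_iff[h1 h2].
rewrite [find_entry _ _]/=; case: Z.ltb_spec => [lt [<- <-]|_]; last exact: IH.
by exists Fm; [exact: h1 | exact: lt].
Qed.

Lemma others_ok fuel z y b w : others fuel z y b = Some w ->
  (b < z * y ^ Z.of_nat w)%Z.
Proof.
elim: fuel z w => [//|f IH] z w /=; case: Z.ltb_spec => [lt [<-]|_].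
  by rewrite Z.mul_1_r.
case E : (others _ _ _ _) => [v|//] [<-].
have := IH _ _ E; rewrite Nat2Z.inj_succ Z.pow_succ_r; first by rewrite Z.mul_assoc.
exact: Zle_0_nat.
Qed.

Lemma leaf_ok k K A B ents y (Dn Qn : seq nat) F b :
  even_lift k K -> (4096 <= A < Z.of_nat K)%Z -> (Z.of_nat K <= B < 2 ^ 38)%Z ->
  List.Forall (entry_ok A B) ents ->
  all prime (2 :: Dn) -> uniq (2 :: Dn) -> all (fun p => p %| K) (2 :: Dn) ->
  (forall p, prime p -> p %| K -> p \notin 2 :: Dn -> y <= p) -> 1 < y ->
  all prime Qn -> uniq Qn -> all (fun q => ~~ (q %| K)) Qn -> all (fun q => q < 100) Qn ->
  (B < Z.of_nat (\prod_(p <- 2%N :: Dn) p) * (b + 1))%Z ->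
  (unit_f * Z.of_nat (\prod_(p <- 2%N :: Dn) p.-1) <= F * Z.of_nat (\prod_(p <- 2%N :: Dn) p))%Z ->
  leaf A ents (Z.of_nat y) (map Z.of_nat Dn) (map Z.of_nat Qn) F b ->
  ~ P_integer k.
Proof.
move=> kK [A0 AK] [KB B38] ents_ok pD uD dD hy y1 pQ uQ dQ Q100 hb hF.
have K0 : 0 < K by move: A0 AK; clear; lia.
rewrite /leaf; case E : (find_entry _ _) => [[u s]|//].
have [Fm e_ok FFm] := find_entry_ok ents_ok E.
case Ew : (others _ _ _ _) => [w|//].
case: Z.ltb_spec => // XR.
set P := \prod_(p <- _ :: Dn) p in hb hF.
have P0 : 0 < P.
  by rewrite /P big_seq; apply: prodn_cond_gt0 => p pL; apply: prime_gt0; apply: (allP pD).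
have hphi : (unit_f * Z.of_nat (totient K) <= F * Z.of_nat K)%Z.
  have := totient_prod_leq K0 uD pD dD; rewrite -/P.
  move: hF; set q := \prod_(p <- _ :: Dn) p.-1 => hF h.
  have h1 : (Z.of_nat (totient K) * Z.of_nat P <= Z.of_nat K * Z.of_nat q)%Z.
    by move: h; move: (totient K); clear; lia.
  have P0' : (0 < Z.of_nat P)%Z by move: P0; clear; lia.
  apply: (proj2 (Z.mul_le_mono_pos_r _ _ _ P0')).
  have : (Z.of_nat K * (unit_f * Z.of_nat q) <= Z.of_nat K * (F * Z.of_nat P))%Z.
    by apply: Z.mul_le_mono_nonneg_l => //; apply: Zle_0_nat.
  have : (unit_f * (Z.of_nat (totient K) * Z.of_nat P) <= unit_f * (Z.of_nat K * Z.of_nat q))%Z.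
    by apply: Z.mul_le_mono_nonneg_l.
  by clear; lia.
have F0 : (0 <= F)%Z by move: hF P0; rewrite /unit_f; clear; nia.
have hc := e_ok F (conj F0 FFm) XR K (totient K) (conj AK KB) hphi.
have hsz : size (primes K) <= 38.
  rewrite leqNgt; apply/negP => h.
  have h1 : 2 ^ 39 <= K by apply: leq_trans (size_primes_pow2 K0); rewrite leq_exp2l.
  have : (Z.of_nat (2 ^ 39) <= Z.of_nat K)%Z by move: h1; move: (2 ^ 39) => ?; clear; lia.
  by rewrite Z_of_expn; move: KB B38; clear; lia.
have hcount := leq_trans (leq_add (leqnn (totient K)) hsz) hc.
have hw : (B < Z.of_nat P * Z.of_nat (y ^ w.+1))%Z.
  have := others_ok Ew; rewrite -Z.pow_succ_r; last exact: Zle_0_nat.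
  rewrite -Nat2Z.inj_succ -Z_of_expn => h; apply: Z.lt_le_trans hb _.
  by apply: Z.mul_le_mono_nonneg_l; [apply: Zle_0_nat | move: h; clear; lia].
have A00 : (0 <= A)%Z by move: A0; clear; lia.
have := leaf_at_ok kK (conj A00 AK) KB XR pD uD dD hy y1 pQ uQ dQ Q100 hw hcount => H.
by case/orP; apply: H.
Qed.

(** Consecutiveness guarantees that after deciding the head, every undecided prime is at least the
    next entry. *)
Fixpoint prime_chain (ps : seq nat) : bool :=
  match ps with
  | [::] => true
  | y :: ps' =>
      [&& prime y, y < 100,
          if ps' is y' :: _ then (y < y') && all (fun p => ~~ prime p) (iota y.+1 (y' - y.+1))
          else true & prime_chain ps']
  end.

Lemma tree_ok k K A B ents qmin ps (Dn Qn : seq nat) F b :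
  even_lift k K -> (4096 <= A < Z.of_nat K)%Z -> (Z.of_nat K <= B < 2 ^ 38)%Z ->
  List.Forall (entry_ok A B) ents -> prime_chain ps ->
  all prime (2 :: Dn) -> uniq (2 :: Dn) -> all (fun p => p %| K) (2 :: Dn) ->
  (forall p y, ohead ps = Some y -> prime p -> p %| K -> p \notin 2 :: Dn -> y <= p) ->
  all prime Qn -> uniq Qn -> all (fun q => ~~ (q %| K)) Qn -> all (fun q => q < 100) Qn ->
  (forall p y, ohead ps = Some y -> p \in 2 :: Dn ++ Qn -> p < y) ->
  (B < Z.of_nat (\prod_(p <- 2%N :: Dn) p) * (b + 1))%Z ->
  (unit_f * Z.of_nat (\prod_(p <- 2%N :: Dn) p.-1) <= F * Z.of_nat (\prod_(p <- 2%N :: Dn) p))%Z ->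
  tree qmin A ents (map Z.of_nat ps) (map Z.of_nat Dn) (map Z.of_nat Qn) F b ->
  ~ P_integer k.
Proof.
move=> kK hA hB ents_ok.
have K0 : 0 < K by move: hA; clear; lia.
elim: ps Dn Qn F b => [//|y ps IH] Dn Qn F b /and4P[py y100 hnext hps] pD uD dD hy pQ uQ dQ Q100 hlt hb hF.
rewrite [tree _ _ _ _ _ _ _ _]/=.
(* With [b = 0] the product of the known prime divisors exceeds [B], so the branch contains no
   [K]. *)
case: Z.eqb_spec => [b0 _|_].
  have : \prod_(p <- 2%N :: Dn) p <= K.
    have := other_primes_bound K0 uD pD dD (fun p h1 h2 h3 => hy p y erefl h1 h2 h3).
    by apply: leq_trans; rewrite leq_pmulr // expn_gt0 prime_gt0.
  by move: hb hB; rewrite b0; move: (\prod_(p <- _) p); clear; lia.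
case: ifP => [/andP[_ hl] _|_].
  apply: leaf_ok kK hA hB ents_ok pD uD dD _ (prime_gt1 py) pQ uQ dQ Q100 hb hF hl.
  by move=> p; apply: hy.
have y_lt p : p \in 2 :: Dn ++ Qn -> p < y by apply: hlt.
have : y \notin 2 :: Dn ++ Qn by apply/negP => /y_lt; rewrite ltnn.
rewrite -cat_cons mem_cat negb_or => /andP[yD yQ].
have next_gt p y' : ohead ps = Some y' -> prime p -> y < p -> y' <= p.
  case: (ps) hnext => [//|z ps'] /andP[yz /allP h] [<-] pp yp.
  rewrite leqNgt; apply/negP => pz; have := h p.
  by rewrite mem_iota pp yp /=; move: pz yz yp; clear; lia.
have next_lt p y' : ohead ps = Some y' -> p <= y -> p < y'.
  case: (ps) hnext => [//|z ps'] /andP[yz _] [<-] h; exact: leq_ltn_trans yz.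
case/andP; case: (boolP (y %| K)) => yK h1 h2.
  move: h1; rewrite -[[:: Z.of_nat y]]/(map Z.of_nat [:: y]) -map_cat.
  have eP f : \prod_(p <- 2 :: (Dn ++ [:: y])) f p = (\prod_(p <- 2 :: Dn) f p) * f y.
    by rewrite -cat_cons big_cat big_seq1.
  apply: IH => //.
  - by rewrite -cat_cons all_cat pD /= py.
  - by rewrite -cat_cons cat_uniq uD /= orbF yD.
  - by rewrite -cat_cons all_cat dD /= yK.
  - move=> p y' e pp pK; rewrite -cat_cons mem_cat negb_or mem_seq1 => /andP[n1 n2].
    apply: (next_gt p y' e pp); rewrite ltn_neqAle eq_sym n2; exact: hy pp pK n1.
  - move=> p y' e; rewrite inE -catA mem_cat.
    move=> h; apply: next_lt e _; move: h.
    case/orP=> [/eqP->|]; first by apply/ltnW/y_lt; rewrite mem_head.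
    case/orP=> [pD'|]; first by apply/ltnW/y_lt; rewrite inE mem_cat pD' orbT.
    rewrite inE => /orP[/eqP->//|pQ'].
    by apply/ltnW/y_lt; rewrite inE mem_cat pQ' !orbT.
  - rewrite (eP id) Nat2Z.inj_mul.
    have y0 : (0 < Z.of_nat y)%Z by have := prime_gt0 py; clear; lia.
    have := Z.mul_succ_div_gt b (Z.of_nat y) y0; rewrite /Z.succ => hd.
    apply: Z.lt_le_trans hb _; rewrite -Z.mul_assoc.
    by apply: Z.mul_le_mono_nonneg_l; [apply: Zle_0_nat | move: hd; clear; lia].
  - rewrite (eP predn) (eP id) !Nat2Z.inj_mul.
    have y0 : (0 < Z.of_nat y)%Z by have := prime_gt0 py; clear; lia.
    (* [F - F / y] rounds F (1 - 1/y) up, so it still bounds totient K / K from above. *)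
    have hd := Z.mul_div_le F (Z.of_nat y) y0.
    have ey : Z.of_nat y.-1 = (Z.of_nat y - 1)%Z by move: y0; clear; lia.
    rewrite ey; move: hF hd y0.
    move: (\prod_(p <- _) p) (\prod_(p <- _) p.-1) (Z.of_nat y) (F / _)%Z => a c z d hF hd z0.
    have : ((z - 1) * (unit_f * Z.of_nat c) <= (z - 1) * (F * Z.of_nat a))%Z.
      by apply: Z.mul_le_mono_nonneg_l => //; move: z0; clear; lia.
    have : (Z.of_nat a * (z * d) <= Z.of_nat a * F)%Z.
      by apply: Z.mul_le_mono_nonneg_l => //; apply: Zle_0_nat.
    by clear; lia.
move: h2; rewrite -[[:: Z.of_nat y]]/(map Z.of_nat [:: y]) -map_cat.
apply: IH => //.
- move=> p y' e pp pK np; apply: (next_gt p y' e pp).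
  rewrite ltn_neqAle; apply/andP; split; last exact: hy pp pK np.
  by apply: contraNneq yK => ->.
- by rewrite all_cat pQ /= py.
- by rewrite cat_uniq uQ /= orbF yQ.
- by rewrite all_cat dQ /= yK.
- by rewrite all_cat Q100 /= y100.
- move=> p y' e; rewrite catA -cat_cons mem_cat mem_seq1 => h; apply: next_lt e _.
  by case/orP: h => [h|/eqP->//]; apply/ltnW/y_lt.
Qed.

Lemma In_take (T : Type) n (l : list T) x : List.In x (take n l) -> List.In x l.
Proof. by elim: l n => [|y l IH] [|n] //= [->|/IH]; [left | right]. Qed.

Lemma In_filter (T : Type) (p : pred T) (l : list T) x :
  List.In x (filter p l) -> List.In x l.
Proof.
elim: l => [|y l IH] //=; case: (p y) => [[->|/IH]|/IH]; [by left | by right | by right].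
Qed.

Lemma tree_chain_ok k K tab qmin Bs ps (Dn Qn : seq nat) F lastA :
  even_lift k K -> List.Forall (fun hg => (0 < hg.2 <= scale)%Z /\
    forall Y, 4096 <= Y -> (Z.of_nat Y < hg.1)%Z ->
     (hg.2 * Z.of_nat Y <= scale * Z.of_nat (prime_count Y))%Z) tab ->
  (lastA < Z.of_nat K)%Z -> (Z.of_nat K <= head lastA Bs)%Z -> last lastA Bs = lastA ->
  all (fun B => (4096 <=? B)%Z && (B <? 2 ^ 38)%Z) Bs ->
  prime_chain ps ->
  all prime (2 :: Dn) -> uniq (2 :: Dn) -> all (fun p => p %| K) (2 :: Dn) ->
  (forall p y, ohead ps = Some y -> prime p -> p %| K -> p \notin 2 :: Dn -> y <= p) ->
  all prime Qn -> uniq Qn -> all (fun q => ~~ (q %| K)) Qn -> all (fun q => q < 100) Qn ->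
  (forall p y, ohead ps = Some y -> p \in 2 :: Dn ++ Qn -> p < y) ->
  (unit_f * Z.of_nat (\prod_(p <- 2%N :: Dn) p.-1) <= F * Z.of_nat (\prod_(p <- 2%N :: Dn) p))%Z ->
  tree_chain qmin tab Bs (map Z.of_nat ps) (map Z.of_nat Dn) (map Z.of_nat Qn) F
     (Z.of_nat (\prod_(p <- 2%N :: Dn) p)) ->
  ~ P_integer k.
Proof.
move=> kK tab_ok Klast Khead Blast Bok hps pD uD dD hy pQ uQ dQ Q100 hlt hF.
elim: Bs Khead Blast Bok => [|B Bs IH] /=; first by move=> h; exfalso; move: h Klast; clear; lia.
case: Bs IH => [|A Bs] IH KB eL /andP[/andP[_ /Z.ltb_lt B38] okB].
  by exfalso; move: KB Klast; rewrite -eL /=; clear; lia.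
case/andP=> ht hc.
have [KA|AK] := Z.le_gt_cases (Z.of_nat K) A; first by apply: IH.
have A0 : (4096 <= A)%Z by case/andP: okB => /andP[/Z.leb_le].
apply: (@tree_ok k K A B _ qmin ps Dn Qn F _ kK _ _ _ hps pD uD dD hy pQ uQ dQ Q100 hlt _ hF ht) => //.
- apply/List.Forall_map/List.Forall_forall => -[h g] hin.
  have [g1 g2] := proj1 (List.Forall_forall _ _) tab_ok (h, g) (In_filter (In_take hin)).
  exact: (@mk_entry_ok A B h g A0 g1 g2).
- have P0 : (0 < Z.of_nat (\prod_(p <- 2%N :: Dn) p))%Z.
    suff : 0 < \prod_(p <- 2 :: Dn) p by move: (\prod_(p <- _) p); clear; lia.
    by rewrite big_seq; apply: prodn_cond_gt0 => p pL; apply: prime_gt0; apply: (allP pD).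
  exact: Z.mul_succ_div_gt.
Qed.

(** * Small moduli: two primes differing by the modulus *)

(** For the largest power of [r] below K / 2, the bound on [r * r] makes the exponent at least 2,
    and the bound on [r * p] puts the power above [p]. *)
Definition shift_witness (K : nat) : Prop :=
  exists r p, [/\ prime r, ~~ (r %| K), 2 * (r * r) < K, 2 * (r * p) < K & prime p && prime (p + K)].

(* The composite is the largest power of [r] below [K / 2]. *)
Lemma shift_witness_not_P_integer k K : even_lift k K -> shift_witness K -> ~ P_integer k.
Proof.
move=> kK [r [p [pr rK r2 rp /andP[pp pq]]]].
have r1 := prime_gt1 pr; have p1 := prime_gt1 pp.
pose h := K.-1 %/ 2; pose i := trunc_log r h.
have h0 : 0 < h by rewrite /h; move: r2 r1; nia.
have ih : r ^ i <= h by apply: trunc_logP.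
have hi : h < r ^ i.+1 by apply: trunc_log_ltn.
have i2 : 1 < i.
  by apply: trunc_log_max => //; rewrite expnS expn1 /h; move: r2; nia.
apply: (@shifted_prime_not_P_integer k K p (r ^ i) kK) => //.
- by rewrite coprimeXl // prime_coprime.
- apply/negP => /primeP[_ /(_ r)]; rewrite -{1}[r]expn1 dvdn_exp2l ?(ltnW i2) // => /(_ isT).
  case/orP=> [/eqP r1'|/eqP e]; first by rewrite r1' in r1.
  by have := ltn_exp2l 1 i r1; rewrite i2 expn1 -e ltnn.
- rewrite ltnNge; apply/negP => le; move: hi rp; rewrite expnS /h.
  have := leq_mul (leqnn r) le; move: (r ^ i) (r * p) => x y; rewrite -/h; nia.
- by move: ih; rewrite /h; move: (r ^ i) => x; lia.
- by apply/eqP => e; move: ih; rewrite e /h; lia.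
Qed.

(** * Certified primality by a sieve and by trial division *)

Inductive trie := TE | TN of bool & trie & trie.

Fixpoint tmem (p : positive) (t : trie) : bool :=
  match t with
  | TE => false
  | TN b l r => match p with xH => b | xO p' => tmem p' l | xI p' => tmem p' r end
  end.

Fixpoint tadd (p : positive) (t : trie) : trie :=
  match p, t with
  | xH, TE => TN true TE TE
  | xH, TN _ l r => TN true l r
  | xO p', TE => TN false (tadd p' TE) TE
  | xO p', TN b l r => TN b (tadd p' l) r
  | xI p', TE => TN false TE (tadd p' TE)
  | xI p', TN b l r => TN b l (tadd p' r)
  end.

Lemma tmem_tadd p t : tmem p (tadd p t).
Proof. by elim: p t => [p IH|p IH|] [|b l r] //=. Qed.

Lemma tmem_tadd_mono p q t : tmem p t -> tmem p (tadd q t).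
Proof.
elim: q p t => [q IH|q IH|] p [|b l r] //=; case: p => [p|p|] //=; exact: IH.
Qed.

(** The next prime is 2081, and 2081^2 = 4330561 is the limit for trial division by this list.
    [base_ok] checks that each odd number from 3 to 2079 has a divisor in it. *)
Definition base_primes : list N :=
  [:: 3; 5; 7; 11; 13; 17; 19; 23; 29; 31; 37; 41; 43; 47; 53; 59; 61; 67; 71; 73; 79; 83; 89;
  97; 101; 103; 107; 109; 113; 127; 131; 137; 139; 149; 151; 157; 163; 167; 173; 179; 181;
  191; 193; 197; 199; 211; 223; 227; 229; 233; 239; 241; 251; 257; 263; 269; 271; 277; 281;
  283; 293; 307; 311; 313; 317; 331; 337; 347; 349; 353; 359; 367; 373; 379; 383; 389; 397;
  401; 409; 419; 421; 431; 433; 439; 443; 449; 457; 461; 463; 467; 479; 487; 491; 499; 503;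
  509; 521; 523; 541; 547; 557; 563; 569; 571; 577; 587; 593; 599; 601; 607; 613; 617; 619;
  631; 641; 643; 647; 653; 659; 661; 673; 677; 683; 691; 701; 709; 719; 727; 733; 739; 743;
  751; 757; 761; 769; 773; 787; 797; 809; 811; 821; 823; 827; 829; 839; 853; 857; 859; 863;
  877; 881; 883; 887; 907; 911; 919; 929; 937; 941; 947; 953; 967; 971; 977; 983; 991; 997;
  1009; 1013; 1019; 1021; 1031; 1033; 1039; 1049; 1051; 1061; 1063; 1069; 1087; 1091; 1093;
  1097; 1103; 1109; 1117; 1123; 1129; 1151; 1153; 1163; 1171; 1181; 1187; 1193; 1201; 1213;
  1217; 1223; 1229; 1231; 1237; 1249; 1259; 1277; 1279; 1283; 1289; 1291; 1297; 1301; 1303;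
  1307; 1319; 1321; 1327; 1361; 1367; 1373; 1381; 1399; 1409; 1423; 1427; 1429; 1433; 1439;
  1447; 1451; 1453; 1459; 1471; 1481; 1483; 1487; 1489; 1493; 1499; 1511; 1523; 1531; 1543;
  1549; 1553; 1559; 1567; 1571; 1579; 1583; 1597; 1601; 1607; 1609; 1613; 1619; 1621; 1627;
  1637; 1657; 1663; 1667; 1669; 1693; 1697; 1699; 1709; 1721; 1723; 1733; 1741; 1747; 1753;
  1759; 1777; 1783; 1787; 1789; 1801; 1811; 1823; 1831; 1847; 1861; 1867; 1871; 1873; 1877;
  1879; 1889; 1901; 1907; 1913; 1931; 1933; 1949; 1951; 1973; 1979; 1987; 1993; 1997; 1999;
  2003; 2011; 2017; 2027; 2029; 2039; 2053; 2063; 2069]%num.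

Definition sieve_bound : N := 125000.

Fixpoint mark (fuel : nat) (cur step : positive) (t : trie) : trie :=
  match fuel with
  | f.+1 => mark f (cur + step) step (tadd cur t)
  | _ => t
  end.

Fixpoint sieve (ps : list N) (t : trie) : trie :=
  match ps with
  | N.pos p :: ps' =>
      sieve ps' (mark (N.to_nat (sieve_bound / (2 * N.pos p))) (3 * p) (2 * p) t)
  | _ :: ps' => sieve ps' t
  | [::] => t
  end.

(** 353 is the largest prime whose square is at most [sieve_bound]. The number 1 is inserted by
    hand. *)
Definition composites : trie :=
  sieve (filter (fun p => p <=? 353)%num base_primes) (tadd 1 TE).

Definition small_prime (ct : trie) (d : N) : bool :=
  match d with N.pos p => ~~ tmem p ct | N0 => false end.

Definition odd_range (n : nat) : list N := map (fun i => N.of_nat i * 2 + 3)%num (iota 0 n).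

Definition base_ok : bool :=
  all (fun n => has (fun p => n mod p =? 0)%num base_primes) (odd_range 1039).

(** 13600 = 2 * 17 * 400: beyond it the size condition holds for all [r <= 17] and [p < 400]. *)
Fixpoint search (ct : trie) (K r : N) (ps : list N) : bool :=
  match ps with
  | [::] => false
  | p :: ps' => ((13600 <? K) || (2 * (r * p) <? K))%num &&
                (small_prime ct (K + p) || search ct K r ps')
  end.

Fixpoint nondivisor (K : N) (rs : list N) : option N :=
  match rs with
  | [::] => None
  | r :: rs' => if (K mod r =? 0)%num then nondivisor K rs' else Some r
  end.

Definition search_at (ct : trie) (sp : list N) (K : N) : bool :=
  if nondivisor K [:: 3; 5; 7; 11; 13; 17]%num is Some r then
    (2 * (r * r) <? K)%num && search ct K r sp
  else false.

Definition exceptions : list N := [:: 36; 42; 48; 60; 90; 112; 114; 210]%num.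

Fixpoint search_loop (ct : trie) (sp : list N) (fuel : nat) (K : N) : bool :=
  match fuel with
  | f.+1 => ((if (K <=? 210)%num then has (N.eqb K) exceptions else false) || search_at ct sp K)
            && search_loop ct sp f (K + 2)
  | _ => true
  end.

Fixpoint shift_loop (ct : trie) (offs : list N) (fuel : nat) (e step : N) : bool :=
  match fuel with
  | f.+1 => has (fun o => small_prime ct (e + o)%num) offs && shift_loop ct offs f (e + step)%num step
  | _ => true
  end.

(** [W mod p] is computed once for all offsets. For [o < p] the sum [r + o] is below [2 * p], so a
    comparison replaces the division. *)
Definition shifts_prime (W : N) (offs : list N) : bool :=
  all (fun p => let r := (W mod p)%num in all (fun o => if (o <? p)%num then ~~ (r + o =? p)%num else ~~ ((r + o) mod p =? 0)%num) offs)
      base_primes.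

(* [(step, off, lo, hi)]: the [K] congruent to [off] modulo [step] in windows that
   start between [lo] and [hi]. *)
Definition progression := (N * N * N * N)%type.

(** The even [K] that the trees leave over: multiples of 5 but not of 3, multiples of 3 but not of
    5, and beyond 2420000 only multiples of 21 not divisible by 5. *)
Definition families : list progression :=
  [:: (30, 10, 0, 1240000); (30, 20, 0, 1240000);
      (30, 6, 0, 2420000); (30, 12, 0, 2420000); (30, 18, 0, 2420000); (30, 24, 0, 2420000);
      (210, 42, 2420001, 4200000); (210, 84, 2420001, 4200000);
      (210, 126, 2420001, 4200000); (210, 168, 2420001, 4200000)]%num.

(** [e] is the least positive value of [W1 - K] over the progression; the loop climbs from there to
    cover the window. *)
Definition progression_ok (ct : trie) (W0 W1 : N) (offs : list N) (f : progression) : bool :=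
  let: (step, off, lo, hi) := f in
  if (lo <=? W0)%num && (W0 <=? hi)%num then
    let e := ((W1 - off - 1) mod step + 1)%num in
    shift_loop ct offs (N.to_nat ((W1 - W0) / step + 1)) e step
  else true.

(** The factor 10 is [2 * r] for [r = 5]: it gives the bound on [r * p] in [shift_witness]. The
    large primes are shared by a whole window, so only the small differences have to be looked up
    for each [K]. *)
Fixpoint windows_ok (ct : trie) (W0 : N) (ws : list (N * list N)) : bool :=
  match ws with
  | [::] => true
  | (W1, offs) :: ws' =>
      [&& (W0 <? W1)%num, ~~ N.odd W1, all N.odd offs,
          all (fun o => (10 * (W1 + o - W0) <? W0)%num && (W1 + o - W0 <=? sieve_bound)%num
                        && (W1 + o <? 4330561)%num) offs,
          shifts_prime W1 offs, all (progression_ok ct W0 W1 offs) families &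
          windows_ok ct W1 ws']
  end.

(* An entry [(W1, offs)] consists of primes [W1 + o]; for each [K] in the window
   that ends at [W1] some [W1 + o - K] is a prime as well. *)
Definition windows : list (N * list N) :=
  [:: (132736, [:: 13; 15; 21; 157; 373; 447; 121; 333; 193; 381; 361; 681; 175; 27; 97]);
  (144416, [:: 81; 23; 167; 45; 173; 315; 11; 153; 35; 321; 195; 125; 483; 467; 501; 65]);
  (157124, [:: 3; 305; 287; 9; 17; 435; 419; 93; 395; 333; 105; 65; 135; 53; 83; 525; 95]);
  (170950, [:: 7; 3; 489; 691; 97; 219; 21; 79; 603; 379; 477; 667; 213; 367; 57; 579]);
  (185992, [:: 1; 279; 445; 387; 21; 115; 121; 57; 169; 165; 427; 15; 559; 111; 45; 235; 79]);
  (202358, [:: 45; 29; 531; 23; 693; 389; 321; 395; 441; 653; 681; 563; 641; 459; 519; 623]);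
  (220164, [:: 5; 193; 197; 409; 209; 517; 305; 373; 647; 25; 389; 205; 697; 425; 509; 535]);
  (239538, [:: 5; 133; 59; 151; 29; 391; 103; 305; 659; 631; 509; 85; 161; 439; 335; 505; 1;
    215]);
  (260616, [:: 55; 101; 107; 553; 551; 655; 13; 191; 175; 473; 61; 233; 305; 613; 367; 137;
    607; 131]);
  (283550, [:: 3; 281; 257; 429; 249; 287; 693; 311; 57; 611; 243; 533; 171; 137; 219; 263;
    21; 29; 267]);
  (308502, [:: 17; 25; 49; 71; 349; 671; 85; 299; 7; 95; 211; 449; 665; 271; 437; 19; 35; 259;
    137; 221]);
  (335650, [:: 13; 291; 267; 229; 171; 43; 429; 247; 97; 69; 379; 183; 613; 471; 31; 303; 193;
    243; 603; 79]);
  (365186, [:: 27; 383; 15; 371; 45; 653; 171; 323; 285; 293; 441; 341; 65; 345; 71; 573; 303;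
    563; 111; 117]);
  (397322, [:: 51; 35; 39; 617; 489; 437; 105; 641; 689; 477; 275; 111; 197; 219; 167; 171;
    267; 107; 401; 227]);
  (432286, [:: 37; 435; 31; 273; 621; 637; 253; 375; 283; 51; 697; 15; 213; 463; 327; 511;
    351; 1; 241; 441; 151]);
  (470326, [:: 7; 135; 633; 631; 607; 363; 615; 457; 453; 295; 681; 511; 225; 301; 393; 85;
    103; 21; 147; 127; 267; 667]);
  (511714, [:: 43; 177; 675; 79; 195; 73; 159; 97; 607; 225; 433; 129; 379; 333; 345; 247;
    117; 283; 555; 145; 87; 619; 153; 277; 493]);
  (556744, [:: 19; 297; 585; 73; 9; 343; 55; 237; 49; 105; 277; 243; 625; 627; 195; 25; 147;
    457; 325; 633; 117; 115; 37; 213]);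
  (605736, [:: 137; 43; 185; 301; 313; 281; 257; 73; 251; 217; 355; 437; 211; 587; 643; 131;
    241; 197; 697; 347; 487; 295; 101; 445]);
  (659040, [:: 23; 19; 7; 461; 473; 211; 499; 557; 589; 191; 197; 571; 119; 181; 617; 61; 653;
    259; 581; 97; 277; 629; 133; 433; 491]);
  (717034, [:: 13; 495; 499; 477; 493; 525; 237; 379; 259; 93; 505; 75; 283; 255; 619; 99;
    415; 633; 307; 547; 663; 297; 55; 57; 115]);
  (780132, [:: 125; 121; 337; 269; 215; 301; 239; 247; 31; 539; 257; 685; 91; 41; 535; 191;
    289; 551; 481; 47; 589; 575; 79; 101; 251; 265]);
  (848782, [:: 25; 21; 57; 349; 61; 345; 7; 699; 211; 159; 67; 75; 97; 441; 421; 321; 637; 15;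
    361; 645; 685; 69; 565; 315; 9; 265]);
  (923474, [:: 39; 35; 27; 443; 395; 117; 569; 213; 335; 567; 93; 509; 143; 219; 677; 489;
    503; 315; 557; 69; 387; 65; 245; 77; 549; 87]);
  (1004738, [:: 9; 11; 5; 393; 59; 405; 23; 369; 531; 281; 333; 479; 675; 341; 249; 611; 423;
    593; 449; 621; 135; 179; 303; 653; 633; 579]);
  (1093154, [:: 9; 5; 153; 287; 129; 95; 143; 249; 527; 273; 47; 135; 545; 579; 437; 255; 683;
    387; 245; 363; 599; 669; 83; 525; 485; 399; 119; 423]);
  (1189350, [:: 53; 367; 271; 569; 407; 541; 353; 679; 277; 281; 119; 253; 263; 457; 551; 451;
    521; 103; 257; 529; 299; 301; 203; 409; 67; 359; 11; 121]);
  (1283544, [:: 29; 175; 157; 173; 163; 209; 337; 215; 187; 359; 503; 223; 439; 287; 47; 253;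
    395; 139; 413; 679; 587; 295; 59; 499; 509; 19; 353; 625; 665; 463]);
  (1393544, [:: 15; 207; 143; 369; 153; 287; 539; 425; 263; 465; 137; 195; 393; 479; 377; 483;
    179; 327; 105; 33; 63]);
  (1503544, [:: 115; 169; 573; 627; 303; 369; 177; 195; 339; 603; 117; 355; 223; 445; 319;
    243; 687; 93; 207; 237; 489; 285; 187; 109]);
  (1613544, [:: 65; 77; 53; 269; 125; 127; 109; 323; 139; 605; 287; 613; 97; 49; 407; 493;
    529; 265; 685; 457; 169; 163]);
  (1723544, [:: 75; 107; 203; 179; 183; 587; 429; 95; 279; 77; 225; 683; 359; 83; 257; 515;
    309; 267; 33; 65; 93; 569]);
  (1833544, [:: 7; 135; 103; 489; 493; 487; 615; 219; 133; 367; 339; 187; 555; 319; 403; 207;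
    595; 217; 109; 237; 417]);
  (1943544, [:: 95; 149; 113; 637; 367; 313; 155; 119; 317; 173; 199; 275; 179; 323; 397; 283;
    295; 259; 107; 379; 583; 17]);
  (2053544, [:: 75; 129; 533; 587; 399; 513; 87; 545; 407; 213; 569; 615; 77; 605; 653; 327;
    689; 99; 465; 9; 267; 177; 159]);
  (2163544, [:: 25; 217; 339; 243; 307; 435; 159; 213; 279; 207; 223; 375; 3; 147; 685; 285;
    679; 577; 469; 127; 493]);
  (2273544, [:: 5; 59; 23; 557; 55; 383; 239; 697; 505; 149; 157; 419; 467; 125; 25; 599; 107;
    199; 565; 473; 583; 17]);
  (2383544, [:: 105; 137; 503; 99; 653; 87; 195; 389; 93; 375; 267; 399; 447; 515; 303; 339;
    297; 219; 135; 363; 129; 207]);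
  (2493544, [:: 55; 109; 513; 537; 525; 379; 657; 333; 15; 573; 177; 669; 273; 99; 447; 693;
    289; 625; 43; 7; 307]);
  (2603544, [:: 383; 517; 95; 389; 305; 623; 307; 179; 683; 199; 137; 19; 247]);
  (2713544, [:: 389; 395; 177; 173; 399; 495; 467; 623; 539; 477; 135; 33; 75; 159]);
  (2823544, [:: 219; 93; 345; 177; 205; 429; 247; 45; 129; 267; 477; 379; 313]);
  (2933544, [:: 679; 553; 427; 5; 259; 187; 215; 103; 383; 419; 685; 139; 173; 19]);
  (3043544, [:: 143; 677; 179; 305; 545; 359; 477; 53; 507; 59; 593; 669; 485]);
  (3153544, [:: 163; 37; 195; 199; 253; 375; 667; 49; 363; 97; 379; 367; 43; 27]);
  (3263544, [:: 169; 127; 55; 503; 95; 287; 403; 53; 659; 635; 305; 83; 293]);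
  (3373544, [:: 209; 83; 335; 377; 503; 479; 245; 87; 173; 9; 149; 137; 243; 45]);
  (3483544, [:: 669; 37; 73; 165; 3; 627; 415; 675; 9; 457; 535; 259; 337]);
  (3593544, [:: 289; 415; 253; 247; 373; 125; 259; 157; 169; 425; 359; 83; 337; 19]);
  (3703544, [:: 363; 237; 395; 279; 147; 669; 425; 333; 179; 327; 693; 87; 543]);
  (3813544, [:: 369; 327; 75; 583; 543; 87; 405; 489; 577; 103; 415; 549; 67; 517]);
  (3923544, [:: 619; 85; 23; 577; 97; 109; 283; 137; 539; 83; 179; 65; 323]);
  (4033544, [:: 659; 533; 435; 237; 47; 309; 273; 285; 197; 545; 287; 399; 75; 177]);
  (4143544, [:: 69; 543; 187; 315; 175; 633; 27; 403; 235; 283; 457; 417; 103; 129]);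
  (4200002, [:: 21; 165; 339; 627; 45; 147; 399; 41; 125; 479; 71])]%num.

Definition direct_check (ct : trie) (sp : list N) : bool :=
  [&& base_ok, all (small_prime ct) sp, search_loop ct sp (N.to_nat 60985) 32 &
      windows_ok ct 122000 windows].

Lemma tmem_mark_mono x fuel cur step t : tmem x t -> tmem x (mark fuel cur step t).
Proof. by elim: fuel cur t => [//|f IH] cur t h /=; apply/IH/tmem_tadd_mono. Qed.

Lemma tmem_mark x fuel cur step t i : i < fuel ->
  N.pos x = (N.pos cur + N.of_nat i * N.pos step)%num -> tmem x (mark fuel cur step t).
Proof.
elim: fuel cur t i => [//|f IH] cur t [|i] lt e /=.
  have -> : x = cur by lia.
  exact/tmem_mark_mono/tmem_tadd.
by apply: (IH _ _ i) => //; lia.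
Qed.

Lemma tmem_sieve_mono x ps t : tmem x t -> tmem x (sieve ps t).
Proof.
by elim: ps t => [//|[|p] ps IH] t h /=; apply: IH => //; apply: tmem_mark_mono.
Qed.

Lemma tmem_sieve x p ps t j : N.pos p \in ps ->
  (N.of_nat j < sieve_bound / (2 * N.pos p))%num ->
  N.pos x = (3 * N.pos p + N.of_nat j * (2 * N.pos p))%num -> tmem x (sieve ps t).
Proof.
move=> hin hj e; elim: ps t hin => [//|q ps IH] t; rewrite inE.
case/orP=> [/eqP <-|h]; last by case: q => [|q] /=; apply: IH.
rewrite [sieve _ _]/=; apply: tmem_sieve_mono; apply: (@tmem_mark _ _ _ _ _ j).
  by move: hj; move: (_ / _)%num => z; lia.
by rewrite e; lia.
Qed.

Lemma N_mod_dvdn (n p : N) : n <> 0%num -> (n mod p = 0)%num -> N.to_nat p %| N.to_nat n.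
Proof.
move=> n0 h; have p0 : p <> 0%num by move=> p0; move: h; rewrite p0; case: (n) n0.
have [q ->] := proj1 (N.mod_divide n p p0) h.
by rewrite N2Nat.inj_mul; apply: dvdn_mull.
Qed.

Definition base_complete : Prop := forall n, odd n -> 3 <= n -> n < 2081 ->
  exists2 p, p \in base_primes & N.to_nat p %| n.

Lemma base_divisor : base_ok -> base_complete.
Proof.
rewrite /base_ok => /allP h n on n3 n2081.
have hin : N.of_nat n \in odd_range 1039.
  apply/mapP; exists (n./2 - 1); first by rewrite mem_iota; lia.
  by lia.
have /hasP[p pb /N.eqb_eq hp] := h _ hin.
exists p => //; rewrite -[n]Nat2N.id; apply: N_mod_dvdn hp; lia.
Qed.

Lemma small_factor n b : ~~ prime n -> 1 < n -> odd n -> n < b * b ->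
  exists e, [/\ prime e, odd e, 3 <= e, e < b & e %| n /\ e * e <= n].
Proof.
move=> np n1 on nb; have pe := pdiv_prime n1; set e := pdiv n in pe.
have en : e %| n := pdiv_dvd n.
have oe : odd e by apply: dvdn_odd en on.
have ee : e * e <= n.
  rewrite leqNgt; apply/negP => h; case/negP: np; apply: ltn_pdiv2_prime; first exact: ltnW.
  by rewrite -/e expnS expn1.
exists e; split => //.
  by move: (prime_gt1 pe) oe; case: (e) => [|[|[|]]].
by rewrite ltnNge; apply/negP => h; have := leq_mul h h; rewrite leqNgt (leq_ltn_trans ee nb).
Qed.

Lemma odd_N_to_nat d : odd (N.to_nat d) = N.odd d.
Proof.
rewrite -[in RHS](N2Nat.id d); elim: (N.to_nat d) => [//|n IH].
by rewrite Nat2N.inj_succ N.odd_succ -N.negb_odd -IH.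
Qed.

Definition sieve_complete (ct : trie) : Prop := forall d, N.odd d -> (d <= sieve_bound)%num ->
  small_prime ct d -> prime (N.to_nat d).

Lemma composites_complete : base_complete -> sieve_complete composites.
Proof.
move=> hb d od hd; case: d od hd => [//|x] od hd; rewrite [small_prime _ _]/=.
apply: contraNT => np; set n := N.to_nat _ in np.
have on : odd n by rewrite odd_N_to_nat.
have [n1|n1] := leqP n 1.
  have -> : x = 1%positive by move: n1; rewrite /n; lia.
  exact/tmem_sieve_mono/tmem_tadd.
have [b bE] : exists b, Z.of_nat b = 354%Z by exists 354.
have nb : n < b * b by move: hd; rewrite /n /sieve_bound; nia.
have [e [pe oe e3 eb [en ee]]] := small_factor np n1 on nb.
have [|p pb pe'] := hb e oe e3; first by move: eb bE; clear; lia.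
have pn := dvdn_trans pe' en; have e0 := prime_gt0 pe.
have ple : N.to_nat p <= e := dvdn_leq e0 pe'.
case: p pb pe' pn ple => [|p] pb pe' pn ple; first by move: pe'; rewrite dvd0n; lia.
have /dvdnP[m nE] := pn.
have om : odd m by move: on; rewrite nE oddM => /andP[].
have m1 : m != 1.
  apply/eqP => m1; move: nE ee e3 ple; rewrite m1 mul1n => ->; clear; nia.
have [j mE] : exists j, m = 2 * j + 3.
  by exists ((m - 3) %/ 2); move: om m1; clear; lia.
have xE : N.pos x = (3 * N.pos p + N.of_nat j * (2 * N.pos p))%num.
  by move: nE; rewrite mE /n; clear; lia.
apply: (@tmem_sieve x p _ _ j _ _ xE); first by rewrite mem_filter pb andbT; move: eb bE ple; clear; lia.
have : (N.of_nat j + 1 <= sieve_bound / (2 * N.pos p))%num; last by lia.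
by apply: N.div_le_lower_bound => //; move: hd; rewrite xE; clear; lia.
Qed.

Lemma search_spec ct K r ps : search ct K r ps ->
  exists p, [/\ p \in ps, ((13600 < K) \/ (2 * (r * p) < K))%num & small_prime ct (K + p)].
Proof.
elim: ps => [//|p ps IH]; rewrite [search _ _ _ _]/= => /andP[h1 /orP[h2|/IH[q [qs h3 h4]]]].
  exists p; split => //; first by rewrite mem_head.
  by case/orP: h1 => [/N.ltb_lt|/N.ltb_lt]; [left | right].
by exists q; split => //; rewrite inE qs orbT.
Qed.

Lemma search_loopS ct sp f K : search_loop ct sp f.+1 K =
  ((if (K <=? 210)%num then has (N.eqb K) exceptions else false) || search_at ct sp K)
  && search_loop ct sp f (K + 2).
Proof. by []. Qed.

Lemma search_loop_spec ct sp fuel K : search_loop ct sp fuel K ->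
  forall i, i < fuel -> (K + 2 * N.of_nat i)%num \in exceptions \/
                        search_at ct sp (K + 2 * N.of_nat i).
Proof.
elim: fuel K => [//|f IH] K; rewrite search_loopS => /andP[h1 h2] [_|i lt].
  rewrite N.add_0_r; case/orP: h1; last by right.
  by case: ifP => // _ /hasP[x xe /N.eqb_eq ->]; left.
have -> : (K + 2 * N.of_nat i.+1 = K + 2 + 2 * N.of_nat i)%num by lia.
exact: IH.
Qed.

Lemma shift_loop_spec ct offs fuel e step : shift_loop ct offs fuel e step ->
  forall i, i < fuel -> exists2 o, o \in offs & small_prime ct (e + N.of_nat i * step + o).
Proof.
elim: fuel e => [//|f IH] e; rewrite [shift_loop _ _ _ _ _]/= => /andP[/hasP[o oo h] h2] [_|i lt].
  by exists o; rewrite ?N.add_0_r.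
have [o' oo' h'] := IH _ h2 i lt; exists o' => //.
by have -> : (e + N.of_nat i.+1 * step = e + step + N.of_nat i * step)%num by lia.
Qed.

Lemma nondivisor_spec K rs r : nondivisor K rs = Some r -> r \in rs /\ (K mod r <> 0)%num.
Proof.
elim: rs => [//|x rs IH]; rewrite [nondivisor _ _]/=; case: N.eqb_spec => [_ /IH[h1 h2]|h [<-]].
  by rewrite inE h1 orbT.
by rewrite mem_head.
Qed.

Lemma N_mod_ndvdn (n p : N) : (n mod p <> 0)%num -> ~~ (N.to_nat p %| N.to_nat n).
Proof.
move=> h; apply/negP => /dvdnP[m e]; apply: h.
have -> : n = (N.of_nat m * p)%num by lia.
case: p {e} => [|p]; last by rewrite N.Div0.mod_mul.
by rewrite N.mul_0_r.
Qed.

Lemma search_at_witness ct K sp : sieve_complete ct ->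
  {in sp, forall p, [/\ (p < 400)%num, N.odd p & small_prime ct p]} ->
  (K <= 122000)%num -> ~~ N.odd K -> search_at ct sp K -> shift_witness (N.to_nat K).
Proof.
move=> hb hsp hK eK; rewrite /search_at; case E : (nondivisor _ _) => [r|//].
have [rin rK] := nondivisor_spec E.
case/andP=> /N.ltb_lt h1 /search_spec[p [ps h2 h3]].
have [p400 op sp_p] := hsp p ps.
have r17 : (r <= 17)%num by move: rin; rewrite !inE => /or4P[|||/or3P[]] /eqP->.
have oKp : N.odd (K + p) by rewrite N.odd_add op (negPf eK).
exists (N.to_nat r), (N.to_nat p); split.
- by move: rin; rewrite !inE => /or4P[|||/or3P[]] /eqP->.
- exact: N_mod_ndvdn.
- by lia.
- by case: h2 => h2; nia.
- have -> : N.to_nat p + N.to_nat K = N.to_nat (K + p) by clear; lia.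
  by rewrite !hb //; rewrite /sieve_bound; lia.
Qed.

Lemma shifts_primeP W offs o : base_complete -> ~~ N.odd W -> N.odd o -> (1 < W)%num -> (W + o < 4330561)%num ->
  shifts_prime W offs -> o \in offs -> prime (N.to_nat (W + o)).
Proof.
move=> hb eW oo hW hq hs oin; apply/negPn/negP => np.
have o1 : (1 <= o)%num by move: oo; case: (o) => //; lia.
set n := N.to_nat _ in np.
have on : odd n by rewrite odd_N_to_nat N.odd_add oo (negPf eW).
have n1 : 1 < n by move: hW; rewrite /n; clear; lia.
have [b bE] : exists b, Z.of_nat b = 2081%Z by exists (Z.to_nat 2081); rewrite Z2Nat.id.
have nb : n < b * b by move: hq; rewrite /n; nia.
have [e [pe oe e3 eb [en ee]]] := small_factor np n1 on nb.
have [|p pb pe'] := hb e oe e3; first by move: eb bE; clear; lia.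
have pn := dvdn_trans pe' en.
have p0 : p <> 0%num.
  by move=> p0; move: pe'; rewrite p0 dvd0n => /eqP e0; rewrite e0 in e3.
move/allP: hs => /(_ p pb) /allP /(_ o oin).
have h : ((W + o) mod p = 0)%num.
  move/dvdnP: pn => [m]; rewrite /n => e'.
  have -> : (W + o = N.of_nat m * p)%num by move: e'; clear; lia.
  exact: N.Div0.mod_mul.
have hr : ((W mod p + o) mod p = 0)%num by rewrite N.Div0.add_mod_idemp_l.
case: N.ltb_spec => [op|_]; last by rewrite hr.
case: N.eqb_spec => // ne _; apply: ne.
have := N.mod_lt W p p0; set r := (W mod p)%num in hr * => rp.
have := N.div_mod' (r + o) p; rewrite hr.
set z := ((r + o) / p)%num => hz.
have : (z = 1)%num by nia.
by move=> z1; rewrite z1 in hz; lia.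
Qed.

Definition active (W0 K : N) (f : progression) : Prop :=
  let: (step, off, lo, hi) := f in
  [/\ (lo <= W0 <= hi)%num, (K mod step = off)%num, (off < step)%num & (step <= 210)%num].

Lemma windows_ok_cons ct W0 W1 offs ws : windows_ok ct W0 ((W1, offs) :: ws) =
  [&& (W0 <? W1)%num, ~~ N.odd W1, all N.odd offs,
      all (fun o => (10 * (W1 + o - W0) <? W0)%num && (W1 + o - W0 <=? sieve_bound)%num
                    && (W1 + o <? 4330561)%num) offs,
      shifts_prime W1 offs, all (progression_ok ct W0 W1 offs) families &
      windows_ok ct W1 ws].
Proof. by []. Qed.

Lemma progression_index W0 W1 K step off : step <> 0%num -> (K mod step = off)%num ->
  (W0 <= K)%num -> (K < W1)%num ->
  exists2 i, i < N.to_nat ((W1 - W0) / step + 1) &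
    (W1 - K = (W1 - off - 1) mod step + 1 + N.of_nat i * step)%num.
Proof.
move=> s0 Kmod W0K KW1; have KE := N.div_mod' K step; rewrite Kmod in KE.
pose d := (W1 - 1 - K)%num.
have -> : (W1 - off - 1 = d + K / step * step)%num.
  by move: KE; rewrite /d; move: (K / step)%num => a; move: KW1; clear; lia.
rewrite N.Div0.mod_add; have dE := N.div_mod' d step.
exists (N.to_nat (d / step)).
  have : (d / step <= (W1 - W0) / step)%num.
    by apply: N.Div0.div_le_mono; rewrite /d; move: W0K KW1; clear; lia.
  by move: (d / step)%num ((W1 - W0) / step)%num => a b; clear; lia.
rewrite N2Nat.id; move: dE; rewrite {1}/d.
by move: (d / step)%num (d mod step)%num => a b; move: KW1; clear; lia.
Qed.

Lemma windows_witness ct W0 ws K : base_complete -> sieve_complete ct -> windows_ok ct W0 ws ->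
  (50 < W0)%num -> (W0 <= K)%num -> (K < last W0 [seq x.1 | x <- ws])%num -> ~~ N.odd K ->
  (exists2 r, r \in [:: 3; 5] & ~~ (r %| N.to_nat K)) ->
  (forall W, (W <= K)%num -> exists2 f, f \in families & active W K f) ->
  shift_witness (N.to_nat K).
Proof.
move=> hb hct; elim: ws W0 => [|[W1 offs] ws IH] W0; first by move=> _ /=; lia.
rewrite windows_ok_cons.
case/and5P=> /N.ltb_lt W01 eW1 ooffs hoffs /and3P[hs hf hws] W50 W0K Klast eK hr hfam.
have [K1|W1K] := N.lt_ge_cases K W1; last first.
  have W50' : (50 < W1)%num by move: W01 W50; clear; lia.
  exact: IH hws W50' W1K Klast eK hr hfam.
have [[[[step off] lo] hi] fin [[lo0 hi0] Kmod offs_lt step210]] := hfam W0 W0K.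
have := allP hf _ fin; rewrite /progression_ok.
rewrite (proj2 (N.leb_le _ _) lo0) (proj2 (N.leb_le _ _) hi0) [_ && _]/=.
set e := ((W1 - off - 1) mod step + 1)%num => hl.
have step0 : step <> 0%num by move: offs_lt; clear; lia.
have [i ilt iE] := progression_index step0 Kmod W0K K1; rewrite -/e in iE.
have [o oin hp] := shift_loop_spec hl ilt.
have [/andP[/andP[/N.ltb_lt h10 /N.leb_le hP] /N.ltb_lt hq] oo] := (allP hoffs o oin, allP ooffs o oin).
move: hp; rewrite -iE => hp.
have pp : prime (N.to_nat (W1 - K + o)).
  apply: hct => //; last by move: hP W0K K1; clear; lia.
  have : N.odd (W1 - K + o + K) by rewrite (_ : W1 - K + o + K = W1 + o)%num ?N.odd_add ?oo ?(negPf eW1) //; move: K1; clear; lia.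
  by rewrite (N.odd_add (W1 - K + o) K) (negPf eK); case: N.odd.
have W1' : (1 < W1)%num by move: W01 W50; clear; lia.
have pq := shifts_primeP hb eW1 oo W1' hq hs oin.
have [r r35 rK] := hr.
have r5 : 3 <= r <= 5 by move: r35; rewrite !inE => /orP[] /eqP->.
exists r, (N.to_nat (W1 - K + o)); split => //.
- by move: r35; rewrite !inE => /orP[] /eqP->.
- by move: r5 W50 W0K; clear; nia.
- by move: r5 h10 W0K K1; clear; nia.
- rewrite pp; have -> : N.to_nat (W1 - K + o) + N.to_nat K = N.to_nat (W1 + o) by move: K1; clear; lia.
  exact: pq.
Qed.

(** * Evaluation of the checks and assembly of the cases *)

Lemma In_rev (T : Type) (l : list T) x : List.In x (rev l) -> List.In x l.
Proof.
suff h m : List.In x (catrev l m) -> List.In x l \/ List.In x m by move/h => [].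
elim: l m => [|y l IH] m /=; first by right.
by move=> /IH[h|[->|h]]; [left; right | left; left | right].
Qed.

Lemma density_list_pos :
  all (fun hg => (0 <? hg.2)%Z && (hg.2 <=? scale)%Z) (rev (density_table 120)).
Proof. by vm_compute. Qed.

(** [grid 120] is 2^42, so the value 41 chosen for [c] in [density_step] serves the whole table. *)
Lemma grid120 : (13 * grid 120 <= 30 * 2 ^ 41)%Z.
Proof. by apply/Z.leb_le; vm_compute. Qed.

Lemma all_In (T : Type) (p : pred T) l x : all p l -> List.In x l -> p x.
Proof. by elim: l => [//|y l IH] /= /andP[py al] [<-//|]; apply: IH. Qed.

Definition density_valid (tab : list (Z * Z)) : Prop :=
  List.Forall (fun hg => (0 < hg.2 <= scale)%Z /\
    forall Y, 4096 <= Y -> (Z.of_nat Y < hg.1)%Z ->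
     (hg.2 * Z.of_nat Y <= scale * Z.of_nat (prime_count Y))%Z) tab.

Lemma density_table_valid n : (13 * grid n <= 30 * 2 ^ 41)%Z ->
  all (fun hg => (0 <? hg.2)%Z && (hg.2 <=? scale)%Z) (rev (density_table n)) ->
  density_valid (rev (density_table n)).
Proof.
move=> hn hpos; apply/List.Forall_forall => -[h g] hin; split.
  by have /andP[/Z.ltb_lt h1 /Z.leb_le h2] := all_In hpos hin; split.
by move=> Y; apply: (density_tableP hn (In_rev hin)).
Qed.

Lemma density_list_valid : density_valid (rev (density_table 120)).
Proof. exact: (@density_table_valid 120 grid120 density_list_pos). Qed.

Definition odd_primes_nat : seq nat :=
  [:: 3; 5; 7; 11; 13; 17; 19; 23; 29; 31; 37; 41; 43; 47; 53; 59; 61; 67; 71; 73; 79; 83].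

Lemma odd_primesE : odd_primes = map Z.of_nat odd_primes_nat.
Proof. by []. Qed.

(* Consecutive entries delimit the ranges [A < K <= B] treated by one decision
   tree each; a shorter range is needed where the margins are thin. *)
Definition main_ranges : list Z :=
  [:: 200000000000; 50000000000; 12500000000; 6250000000; 3125000000; 781250000;
      312500000; 183823529; 61274509; 30637254; 15318627; 9010957; 6674782; 5339825;
      4767700; 4200000]%Z.
Definition ranges_coprime15 : list Z :=
  [:: 4200000; 1075000; 430000; 252941; 200000; 168627; 150000; 135000; 130000; 126000;
      123000; 122000; 121500]%Z.
Definition ranges_5 : list Z := [:: 4200000; 2529411; 1487888; 1260922; 1240000]%Z.
Definition ranges_3 : list Z :=
  [:: 4200000; 3644067; 3253631; 2905027; 2870000; 2848065; 2500000; 2420000]%Z.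
Definition ranges_15 : list Z :=
  [:: 4200000; 2000000; 1433333; 716666; 358333; 238888; 180000; 140522; 100000; 70261;
      52045; 30614; 24491; 20000; 19592; 19300; 19100]%Z.

(** The initial [F] is the product of 1 - 1/p over 2 and the prescribed divisors, rounded up in
    units of 1 / [unit_f]; the last argument is the product of these primes. *)
Definition tree_check (tab : list (Z * Z)) : bool :=
  [&& tree_chain 3 tab main_ranges odd_primes [::] [::] 5000000 2,
      tree_chain 3 tab ranges_coprime15 (drop 2 odd_primes) [::] [:: 3; 5]%Z 5000000 2,
      tree_chain 3 tab ranges_5 (drop 2 odd_primes) [:: 5]%Z [:: 3]%Z 4000000 10,
      tree_chain 3 tab ranges_3 (drop 3 odd_primes) [:: 3]%Z [:: 5; 7]%Z 3333334 6 &
      tree_chain 3 tab ranges_15 (drop 2 odd_primes) [:: 3; 5]%Z [::] 2666667 30].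

Lemma tree_checked : tree_check (rev (density_table 120)).
Proof. vm_cast_no_check (@erefl bool true). Qed.

Lemma prime_cases p : prime p -> p < 11 -> p \in [:: 2; 3; 5; 7].
Proof. by do 11 (case: p => [//|p]). Qed.

Lemma even_lift_dvd2 k K : even_lift k K -> 2 %| K.
Proof. by case=> eK _; rewrite dvdn2. Qed.

Lemma chain_not_P_integer k K tab Bs ps (Dn Qn : seq nat) F fd lastA :
  even_lift k K -> density_valid tab ->
  tree_chain 3 tab Bs (map Z.of_nat ps) (map Z.of_nat Dn) (map Z.of_nat Qn) F fd ->
  (lastA < Z.of_nat K)%Z -> (Z.of_nat K <= head lastA Bs)%Z -> last lastA Bs = lastA ->
  all (fun B => (4096 <=? B)%Z && (B <? 2 ^ 38)%Z) Bs ->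
  prime_chain ps -> all prime Dn -> uniq Dn -> 2 \notin Dn -> all (fun p => p %| K) Dn ->
  all prime Qn -> uniq Qn -> all (fun q => ~~ (q %| K)) Qn ->
  (forall p y, ohead ps = Some y -> prime p -> (p < y) = (p \in 2 :: Dn ++ Qn)) ->
  all (fun q => q < 100) Qn ->
  fd = Z.of_nat (\prod_(p <- 2%N :: Dn) p) ->
  (unit_f * Z.of_nat (\prod_(p <- 2%N :: Dn) p.-1) <= F * fd)%Z ->
  ~ P_integer k.
Proof.
move=> kK tabv hc h1 h2 h3 h4 hps pD uD nD dD pQ uQ dQ hlt Q100 fdE hF; subst fd.
have pD2 : all prime (2 :: Dn) by rewrite /= pD.
apply: (tree_chain_ok kK tabv h1 h2 h3 h4 hps pD2 _ _ _ pQ uQ dQ Q100 _ hF hc).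
- by rewrite /= nD.
- by rewrite /= dD (even_lift_dvd2 kK).
- move=> p y e pp pK; rewrite leqNgt; apply: contra; rewrite (hlt p y e pp) -cat_cons mem_cat.
  by case/orP=> // /(allP dQ); rewrite pK.
- move=> p y e pin; rewrite (hlt p y e) //; move: pin; rewrite -cat_cons mem_cat.
  by case/orP=> [/(allP pD2)|/(allP pQ)].
Qed.

Lemma mem_small_primes p y (s : seq nat) : y <= 11 -> prime p ->
  all (fun q => (q < y) == (q \in s)) [:: 2; 3; 5; 7] -> all (fun q => q < y) s ->
  (p < y) = (p \in s).
Proof.
move=> y11 pp /allP h /allP hs; have [p11|p11] := ltnP p 11.
  by have /eqP := h p (prime_cases pp p11).
have -> : (p < y) = false by apply/negbTE; rewrite -leqNgt; apply: leq_trans p11.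
by apply/esym/negbTE/negP => /hs; rewrite ltnNge (leq_trans y11 p11).
Qed.

Lemma tree_cover k K : even_lift k K -> (Z.of_nat K <= 200000000000)%Z ->
  [\/ (4200000 < Z.of_nat K)%Z,
      [/\ ~~ (3 %| K), ~~ (5 %| K) & (121500 < Z.of_nat K)%Z],
      [/\ ~~ (3 %| K), 5 %| K & (1240000 < Z.of_nat K)%Z] |
      3 %| K /\ ([/\ ~~ (5 %| K), ~~ (7 %| K) & (2420000 < Z.of_nat K)%Z] \/
                 (5 %| K /\ (19100 < Z.of_nat K)%Z))] ->
  ~ P_integer k.
Proof.
move=> kK K2; have := tree_checked; move: density_list_valid.
move: (rev (density_table 120)) => tab tv.
rewrite /tree_check odd_primesE => /and5P[c1 c2 c3 c4 c5].
have [big|small] := Z.lt_ge_cases 4200000 (Z.of_nat K).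
  move=> _; apply: (@chain_not_P_integer k K tab main_ranges odd_primes_nat [::] [::] _ _ 4200000 kK tv c1); clear c1 c2 c3 c4 c5 => //.
  - by move=> p y [<-] pp; apply: mem_small_primes.
  - by rewrite unlock.
  - by rewrite unlock.
case=> [h|[d3 d5 h]|[d3 d5 h]|[d3 [[d5 d7 h]|[d5 h]]]].
- by move: small h; clear; lia.
- apply: (@chain_not_P_integer k K tab ranges_coprime15 (drop 2 odd_primes_nat) [::] [:: 3; 5] _ _ 121500 kK tv c2); clear c1 c2 c3 c4 c5 => //.
  + by rewrite /= d3 d5.
  + by move=> p y [<-] pp; apply: mem_small_primes.
  + by rewrite unlock.
  + by rewrite unlock.
- apply: (@chain_not_P_integer k K tab ranges_5 (drop 2 odd_primes_nat) [:: 5] [:: 3] _ _ 1240000 kK tv c3); clear c1 c2 c3 c4 c5 => //.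
  + by rewrite /= d5.
  + by rewrite /= d3.
  + by move=> p y [<-] pp; apply: mem_small_primes.
  + by rewrite unlock.
  + by rewrite unlock.
- apply: (@chain_not_P_integer k K tab ranges_3 (drop 3 odd_primes_nat) [:: 3] [:: 5; 7] _ _ 2420000 kK tv c4); clear c1 c2 c3 c4 c5 => //.
  + by rewrite /= d3.
  + by rewrite /= d5 d7.
  + by move=> p y [<-] pp; apply: mem_small_primes.
  + by rewrite unlock.
  + by rewrite unlock.
- apply: (@chain_not_P_integer k K tab ranges_15 (drop 2 odd_primes_nat) [:: 3; 5] [::] _ _ 19100 kK tv c5); clear c1 c2 c3 c4 c5 => //.
  + by rewrite /= d3 d5.
  + by move=> p y [<-] pp; apply: mem_small_primes.
  + by rewrite unlock.
  + by rewrite unlock.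
Qed.

Definition search_primes : list N := filter (fun p => p <? 400)%num base_primes.

Lemma direct_checked : direct_check composites search_primes.
Proof. vm_cast_no_check (@erefl bool true). Qed.

Lemma base_primes_odd : all N.odd base_primes.
Proof. by vm_compute. Qed.

Lemma search_primesP p : p \in search_primes -> (p < 400)%num /\ N.odd p.
Proof.
rewrite mem_filter => /andP[/N.ltb_lt h pb]; split; first exact: h.
exact: (allP base_primes_odd).
Qed.

Lemma windows_end : last 122000%num [seq x.1 | x <- windows] = 4200002%num.
Proof. by []. Qed.

(** These [K] are too small for the size conditions of the search. A hand-picked pair [p], [c]
    works, where [c] may have two different prime factors. *)
Lemma exceptional_not_P_integer k K : even_lift k K -> N.of_nat K \in exceptions ->
  ~ P_integer k.
Proof.
move=> kK hx; have : K \in [seq N.to_nat x | x <- exceptions].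
  by apply/mapP; exists (N.of_nat K); rewrite ?Nat2N.id.
rewrite (_ : map _ _ = [:: 36; 42; 48; 60; 90; 112; 114; 210]) // {hx} !inE.
case/orP=> [/eqP e|]; first by apply: (@shifted_prime_not_P_integer k K 5 35 kK); rewrite ?e.
case/orP=> [/eqP e|]; first by apply: (@shifted_prime_not_P_integer k K 5 25 kK); rewrite ?e.
case/orP=> [/eqP e|]; first by apply: (@shifted_prime_not_P_integer k K 5 35 kK); rewrite ?e.
case/orP=> [/eqP e|]; first by apply: (@shifted_prime_not_P_integer k K 7 49 kK); rewrite ?e.
case/orP=> [/eqP e|]; first by apply: (@shifted_prime_not_P_integer k K 7 77 kK); rewrite ?e.
case/orP=> [/eqP e|]; first by apply: (@shifted_prime_not_P_integer k K 19 111 kK); rewrite ?e.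
case/orP=> [/eqP e|]; first by apply: (@shifted_prime_not_P_integer k K 13 91 kK); rewrite ?e.
by move/eqP=> e; apply: (@shifted_prime_not_P_integer k K 13 209 kK); rewrite ?e.
Qed.

Lemma N_of_modn m d r : 0 < d -> m %% d = r -> (N.of_nat m mod N.of_nat d = N.of_nat r)%num.
Proof.
move=> d0 <-; apply/esym/(N.mod_unique _ _ (N.of_nat (m %/ d))).
  by have := ltn_pmod m d0; move: (m %% d) => x; clear; lia.
by have := divn_eq m d; move: (m %/ d) (m %% d) => x y; clear; lia.
Qed.

Lemma direct_cover K : ~~ odd K -> 32 <= K ->
  [\/ (Z.of_nat K <= 122000)%Z,
      [/\ ~~ (3 %| K), 5 %| K & (Z.of_nat K <= 1240000)%Z],
      [/\ 3 %| K, ~~ (5 %| K) & (Z.of_nat K <= 2420000)%Z] |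
      [/\ 3 %| K, ~~ (5 %| K), 7 %| K & (Z.of_nat K <= 4200000)%Z]] ->
  N.of_nat K \in exceptions \/ shift_witness K.
Proof.
move=> eK K32; have := direct_checked; rewrite /direct_check.
have := composites_complete; move: search_primesP windows_end.
move: composites search_primes windows => ct sp ws hsp wend hct /and4P[hb hspct hse hwi].
have bc := base_divisor hb; clear hb.
have sc := hct bc; clear hct.
have oK : ~~ N.odd (N.of_nat K) by rewrite -odd_N_to_nat Nat2N.id.
have [small|big] := Z.le_gt_cases (Z.of_nat K) 122000.
  move=> _; have [|hx|hx] := search_loop_spec hse (_ : (K - 32) %/ 2 < _).
  - by move: small K32; clear; lia.
  - left; move: hx; rewrite (_ : 32 + 2 * N.of_nat ((K - 32) %/ 2) = N.of_nat K)%num //.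
    by move: eK K32; clear; lia.
  right; rewrite -[K]Nat2N.id; apply: (search_at_witness sc _ _ oK).
  - by move=> p ps; have [h1 h2] := hsp p ps; split => //; apply: (allP hspct).
  - by move: small; clear; lia.
  - move: hx; rewrite (_ : 32 + 2 * N.of_nat ((K - 32) %/ 2) = N.of_nat K)%num //.
    by move: eK K32; clear; lia.
move=> hyp; right; rewrite -[K]Nat2N.id.
have Klt : (N.of_nat K < 4200002)%num.
  by case: hyp => [h|[_ _ h]|[_ _ h]|[_ _ _ h]]; move: h; clear; lia.
rewrite -wend in Klt.
apply: (windows_witness bc sc hwi _ _ Klt oK).
- by [].
- by move: big; clear; lia.
- rewrite Nat2N.id; case: hyp => [h|[h _ _]|[_ h _]|[_ h _ _]].
  + by move: h big; clear; lia.
  + by exists 3.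
  + by exists 5.
  + by exists 5.
- have m30 : K %% 30 < 30 by rewrite ltn_mod.
  have m210 : K %% 210 < 210 by rewrite ltn_mod.
  move=> W WK; case: hyp => [h|[d3 d5 h]|[d3 d5 h]|[d3 d5 d7 h]].
  + by move: h big; clear; lia.
  + have : (N.of_nat K mod 30 = 10 \/ N.of_nat K mod 30 = 20)%num.
      have : K %% 30 = 10 \/ K %% 30 = 20 by move: eK d3 d5; clear; lia.
      by case=> /(@N_of_modn K 30 _ isT) e; [left | right]; exact: e.
    by case=> e; [exists (30, 10, 0, 1240000)%num | exists (30, 20, 0, 1240000)%num];
      rewrite ?inE ?eqxx //; split => //; move: WK h; clear; lia.
  + have : (N.of_nat K mod 30 = 6 \/ N.of_nat K mod 30 = 12 \/
            N.of_nat K mod 30 = 18 \/ N.of_nat K mod 30 = 24)%num.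
      have : K %% 30 = 6 \/ K %% 30 = 12 \/ K %% 30 = 18 \/ K %% 30 = 24.
        by move: eK d3 d5; clear; lia.
      by case=> [|[|[|]]] /(@N_of_modn K 30 _ isT) e;
        [left; exact: e | right; left; exact: e | right; right; left; exact: e | right; right; right; exact: e].
    by case=> [e|[e|[e|e]]];
      [exists (30, 6, 0, 2420000)%num | exists (30, 12, 0, 2420000)%num |
       exists (30, 18, 0, 2420000)%num | exists (30, 24, 0, 2420000)%num];
      rewrite ?inE ?eqxx //; split => //; move: WK h; clear; lia.
  + have : (N.of_nat K mod 210 = 42 \/ N.of_nat K mod 210 = 84 \/
            N.of_nat K mod 210 = 126 \/ N.of_nat K mod 210 = 168)%num.
      have : K %% 210 = 42 \/ K %% 210 = 84 \/ K %% 210 = 126 \/ K %% 210 = 168.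
        by move: eK d3 d5 d7; clear; lia.
      by case=> [|[|[|]]] /(@N_of_modn K 210 _ isT) e;
        [left; exact: e | right; left; exact: e | right; right; left; exact: e | right; right; right; exact: e].
    have : (N.of_nat K mod 30 = 6 \/ N.of_nat K mod 30 = 12 \/
            N.of_nat K mod 30 = 18 \/ N.of_nat K mod 30 = 24)%num.
      have : K %% 30 = 6 \/ K %% 30 = 12 \/ K %% 30 = 18 \/ K %% 30 = 24.
        by move: eK d3 d5; clear; lia.
      by case=> [|[|[|]]] /(@N_of_modn K 30 _ isT) e;
        [left; exact: e | right; left; exact: e | right; right; left; exact: e | right; right; right; exact: e].
    (* Windows that start up to 2420000 already treat all these classes modulo 30; only later ones
       are restricted to multiples of 7. *)
    have [Wb|Ws] := N.lt_ge_cases 2420000 W.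
      move=> _; case=> [e|[e|[e|e]]];
      [exists (210, 42, 2420001, 4200000)%num | exists (210, 84, 2420001, 4200000)%num |
       exists (210, 126, 2420001, 4200000)%num | exists (210, 168, 2420001, 4200000)%num];
      rewrite ?inE ?eqxx //; split => //; move: WK h Wb; clear; lia.
    case=> [e|[e|[e|e]]] _;
      [exists (30, 6, 0, 2420000)%num | exists (30, 12, 0, 2420000)%num |
       exists (30, 18, 0, 2420000)%num | exists (30, 24, 0, 2420000)%num];
      rewrite ?inE ?eqxx //; split => //; move: Ws; clear; lia.
Qed.

Lemma even_lift_not_P_integer k K : even_lift k K -> 32 <= K ->
  (Z.of_nat K <= 200000000000)%Z -> ~ P_integer k.
Proof.
move=> kK K32 K2.
have tc := tree_cover kK K2.
have dc (h : [\/ (Z.of_nat K <= 122000)%Z,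
      [/\ ~~ (3 %| K), 5 %| K & (Z.of_nat K <= 1240000)%Z],
      [/\ 3 %| K, ~~ (5 %| K) & (Z.of_nat K <= 2420000)%Z] |
      [/\ 3 %| K, ~~ (5 %| K), 7 %| K & (Z.of_nat K <= 4200000)%Z]]) : ~ P_integer k.
  have eK : ~~ odd K by case: kK.
  have [hx|hw] := direct_cover eK K32 h; first exact: exceptional_not_P_integer kK hx.
  exact: shift_witness_not_P_integer kK hw.
have [K4|K4] := Z.lt_ge_cases 4200000 (Z.of_nat K); first by apply: tc; constructor 1.
have [K1|K1] := Z.le_gt_cases (Z.of_nat K) 122000; first by apply: dc; constructor 1.
have [d3|d3] := boolP (3 %| K); have [d5|d5] := boolP (5 %| K).
- by apply: tc; constructor 4; split=> //; right; split=> //; lia.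
- have [K3|K3] := Z.le_gt_cases (Z.of_nat K) 2420000; first by apply: dc; constructor 3.
  have [d7|d7] := boolP (7 %| K); first by apply: dc; constructor 4; split=> //; lia.
  by apply: tc; constructor 4; split=> //; left.
- have [K3|K3] := Z.le_gt_cases (Z.of_nat K) 1240000; first by apply: dc; constructor 2.
  by apply: tc; constructor 3.
- by apply: tc; constructor 2; split=> //; lia.
Qed.

Lemma Z_of_leq m n : m <= n -> (Z.of_nat m <= Z.of_nat n)%Z.
Proof. by lia. Qed.

Theorem theorem4p1 (k : nat) :
  (30 < k <= 10 ^ 11 -> ~ P_integer k) /\
  (~~ odd k -> 30 < k <= 2 * 10 ^ 11 -> ~ P_integer k).
Proof.
have even_case : ~~ odd k -> 30 < k -> (Z.of_nat k <= 200000000000)%Z -> ~ P_integer k.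
  move=> ek k30; apply: (@even_lift_not_P_integer k k); first by split=> //; left.
  by move: ek k30; clear; lia.
split=> [/andP[k30 /Z_of_leq]|ek /andP[k30 /Z_of_leq]]; last first.
  by rewrite Nat2Z.inj_mul Z_of_expn; apply: even_case.
rewrite Z_of_expn => k11; have {}k11 : (Z.of_nat k <= 100000000000)%Z := k11.
have [ok|ek] := boolP (odd k); last by apply: even_case => //; lia.
apply: (@even_lift_not_P_integer k k.*2); last by lia.
  by rewrite /even_lift odd_double; split=> //; right.
by move: k30; clear; lia.
Qed.
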